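(* The canonical class $o(S)$ is a Morita invariant. That is, let $K$ be a field and let $S$ and $R$ be Morita equivalent (unital) associative $K$-algebras. Then, under the isomorphism $$H^3\big(H^0(S,S),H^1(S,S),H^0(S,S)\big)\cong H^3\big(H^0(R,R),H^1(R,R),H^0(R,R)\big)$$ induced by the canonical isomorphisms $H^0(S,S)\cong H^0(R,R)$ and $H^1(S,S)\cong H^1(R,R)$ given by the Morita invariance of Hochschild cohomology, the class $o(S)$ corresponds to $o(R)$.
   Context: $\otimes$ means $\otimes_K$, and $H^*(S,S)$ is the Hochschild cohomology of $S$ over $K$. Morita equivalence is meant over $K$. **Lie--Rinehart algebras and modules.** For a commutative $K$-algebra $A$, a Lie--Rinehart algebra over $A$ is a Lie $K$-algebra $\mathcal L$ with an $A$-module structure and a Lie algebra and $A$-module homomorphism $\alpha:\mathcal L\to\mathrm{Der}(A)$ such that $[X,aY]=a[X,Y]+X(a)Y$, where $X(a):=\alpha(X)(a)$. A Lie--Rinehart module over $\mathcal L$ is an $A$-module $M$ which is also a module over the Lie $K$-algebra $\mathcal L$, with $(aX)(m)=a(X(m))$ and $X(am)=aX(m)+X(a)m$. **The cohomology $H^*(A,\mathcal L,M)$.** For a Lie--Rinehart algebra $\mathcal L$, $A\otimes\mathcal L$ is a Lie--Rinehart algebra over $A$ with bracket $[a\otimes X,b\otimes Y]=ab\otimes[X,Y]+aX(b)\otimes Y-bY(a)\otimes X$ and anchor $(a\otimes X)(b)=aX(b)$, $A$ acting on the first factor; iterating, each $A^{\otimes p}\otimes\mathcal L$ is a Lie--Rinehart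 algebra. Put $C^{pq}=\mathrm{Hom}_K(\Lambda^q_K(A^{\otimes p}\otimes\mathcal L),M)$ for $p,q\ge0$, where $A^{\otimes p}\otimes\mathcal L$ acts on $M$ by $(a_1\otimes\cdots\otimes a_p\otimes X)m=(a_1\cdots a_pX)m$. The vertical differential $\delta:C^{p,q-1}\to C^{p,q}$ is $(-1)^q$ times the Chevalley--Eilenberg differential $$f\mapsto\sum_i(-1)^{i-1}X_if(\dots,\hat X_i,\dots)+\sum_{j<k}(-1)^{j+k}f([X_j,X_k],\dots,\hat X_j,\dots,\hat X_k,\dots).$$ The horizontal differential $d:C^{pq}\to C^{p+1,q}$ is given, for $u_j=a_{0j}\otimes a_{1j}\otimes\cdots\otimes a_{pj}\otimes X_j$, $1\le j\le q$, by $$(df)(u_1,\dots,u_q)=\Big(\prod_j a_{0j}\Big)f(u'_1,\dots,u'_q)+\sum_{0\le i<p}(-1)^{i+1}f(m_iu_1,\dots,m_iu_q)+(-1)^{p+1}f(eu_1,\dots,eu_q),$$ where $u'_j=a_{1j}\otimes\cdots\otimes a_{pj}\otimes X_j$, $m_i$ multiplies the adjacent entries $a_{ij}a_{i+1,j}$, and $eu_j=a_{0j}\otimes\cdots\otimes a_{p-1,j}\otimes a_{pj}X_j$. $H^*(A,\mathcal L,M)$ is the cohomology of the total complex, with differential $d+(-1)^p\delta$ on $C^{pq}$. **The crossed module of $S$.** Let $A=H^0(S,S)$ be the center of $S$, $\mathrm{Der}(S)$ the Lie $K$-algebra of $K$-derivations of $S$, and $\mathrm{ad}:S\to\mathrm{Der}(S)$,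 $\mathrm{ad}(s)(x)=sx-xs$. Then $\mathrm{Der}(S)$ is a Lie--Rinehart algebra over $A$ with $(aD)(s)=aD(s)$ and anchor given by restriction of derivations to $A$; $\mathrm{Der}(S)$ acts on $S$ by $(D,s)\mapsto D(s)$; $H^1(S,S)=\mathrm{Coker}(\mathrm{ad})$ is a Lie--Rinehart algebra over $A$; and $A=\mathrm{Ker}(\mathrm{ad})$ is a Lie--Rinehart module over $H^1(S,S)$. The exact sequence $$0\to A\to S\xrightarrow{\ \mathrm{ad}\ }\mathrm{Der}(S)\to H^1(S,S)\to0$$ is a crossed extension of $H^1(S,S)$ by $A$. **The canonical class.** $o(S)\in H^3(A,H^1(S,S),A)$ is the class of this crossed extension under the natural bijection between connected components of crossed extensions and $H^3$. Explicitly, put $\mathcal L=H^1(S,S)$ and choose $K$-linear sections $p:\mathcal L\to\mathrm{Der}(S)$ of the projection and $q:\mathrm{Im}(\mathrm{ad})\to S$ of $\mathrm{ad}$. For $X,Y\in\mathcal L$, $a\in A$ put $t(X,Y)=q([p(X),p(Y)]-p([X,Y]))$ and $s(a\otimes X)=q(a\,p(X)-p(aX))$. Then $o(S)$ is represented by the total 3-cocycle with components $f\in C^{03}$, $g\in C^{12}$, $h\in C^{21}$ (and $0\in C^{30}$), where $$f(X,Y,Z)=-\big(p(X)t(Y,Z)-p(Y)t(X,Z)+p(Z)t(X,Y)-t([X,Y],Z)+t([X,Z],Y)-t([Y,Z],X)\big),$$ and for $u=a\otimes X$, $v=b\otimes Y$, $$g(u,v)=ab\,t(X,Y)-t(aX,bY)-\big(p(aX)s(v)-p(bY)s(u)-s([u,v])+[s(u),s(v)]\big),$$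 $$h(a\otimes b\otimes X)=a\,s(b\otimes X)-s(ab\otimes X)+s(a\otimes bX).$$ The class is independent of the choices of $p$ and $q$. *)

(* Defs.v *)
From HB Require Import structures.
From mathcomp Require Import all_boot all_order all_algebra.
From mathcomp Require Import boolp classical_sets functions.

Set Implicit Arguments.
Unset Strict Implicit.
Unset Printing Implicit Defensive.

Import GRing.Theory.
Local Open Scope ring_scope.
Local Open Scope quotient_scope.

Record setoid_lmod (K : fieldType) := SetoidLmod {
  sl_car : choiceType;
  sl_eq : sl_car -> sl_car -> Prop;
  sl_zero : sl_car;
  sl_opp : sl_car -> sl_car;
  sl_add : sl_car -> sl_car -> sl_car;
  sl_scale : K -> sl_car -> sl_car;
  sl_refl : forall x, sl_eq x x;
  sl_sym : forall x y, sl_eq x y -> sl_eq y x;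
  sl_trans : forall x y z, sl_eq x y -> sl_eq y z -> sl_eq x z;
  sl_opp_eq : forall x y, sl_eq x y -> sl_eq (sl_opp x) (sl_opp y);
  sl_add_eq : forall x x' y y', sl_eq x x' -> sl_eq y y' ->
    sl_eq (sl_add x y) (sl_add x' y');
  sl_scale_eq : forall k x y, sl_eq x y -> sl_eq (sl_scale k x) (sl_scale k y);
  sl_addA : forall x y z, sl_eq (sl_add x (sl_add y z)) (sl_add (sl_add x y) z);
  sl_addC : forall x y, sl_eq (sl_add x y) (sl_add y x);
  sl_add0 : forall x, sl_eq (sl_add sl_zero x) x;
  sl_addN : forall x, sl_eq (sl_add (sl_opp x) x) sl_zero;
  sl_scaleA : forall a b x,
    sl_eq (sl_scale a (sl_scale b x)) (sl_scale (a * b) x);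
  sl_scale1 : forall x, sl_eq (sl_scale 1 x) x;
  sl_scaleDr : forall a x y,
    sl_eq (sl_scale a (sl_add x y)) (sl_add (sl_scale a x) (sl_scale a y));
  sl_scaleDl : forall a b x,
    sl_eq (sl_scale (a + b) x) (sl_add (sl_scale a x) (sl_scale b x)) }.

Section SetoidQuotient.
Variables (K : fieldType) (X : setoid_lmod K).

Definition sl_rel : rel (sl_car X) := fun x y => `[< sl_eq x y >].

Lemma sl_rel_refl : reflexive sl_rel.
Proof. by move=> x; apply/asboolP; exact: sl_refl. Qed.
Lemma sl_rel_sym : symmetric sl_rel.
Proof. by move=> x y; apply/asboolP/asboolP; exact: sl_sym. Qed.
Lemma sl_rel_trans : transitive sl_rel.
Proof.
by move=> y x z /asboolP xy /asboolP yz; apply/asboolP; exact: sl_trans xy yz.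
Qed.

Canonical sl_equiv := EquivRel sl_rel sl_rel_refl sl_rel_sym sl_rel_trans.

Definition squot := {eq_quot sl_equiv}.
HB.instance Definition _ := Choice.on squot.

Definition sclass (x : sl_car X) : squot := \pi_squot x.
Definition srepr (u : squot) : sl_car X := repr u.

Lemma sreprK u : sclass (srepr u) = u.
Proof. exact: reprK. Qed.

Lemma sclassP x y : sclass x = sclass y <-> sl_eq x y.
Proof.
by split=> [/eqmodP/asboolP //|xy]; apply/eqmodP/asboolP.
Qed.

Lemma srepr_class x : sl_eq (srepr (sclass x)) x.
Proof. by apply/sclassP; rewrite sreprK. Qed.

Definition squot_add u v := sclass (sl_add (srepr u) (srepr v)).
Definition squot_opp u := sclass (sl_opp (srepr u)).
Definition squot_scale k u := sclass (sl_scale k (srepr u)).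

Lemma squot_addE x y : squot_add (sclass x) (sclass y) = sclass (sl_add x y).
Proof. by apply/sclassP; apply: sl_add_eq; exact: srepr_class. Qed.
Lemma squot_oppE x : squot_opp (sclass x) = sclass (sl_opp x).
Proof. by apply/sclassP; apply: sl_opp_eq; exact: srepr_class. Qed.
Lemma squot_scaleE k x : squot_scale k (sclass x) = sclass (sl_scale k x).
Proof. by apply/sclassP; apply: sl_scale_eq; exact: srepr_class. Qed.

Lemma squotP (P : squot -> Prop) : (forall x, P (sclass x)) -> forall u, P u.
Proof. by move=> h u; rewrite -(sreprK u). Qed.

Lemma squot_addA : associative squot_add.
Proof.
elim/squotP=> x; elim/squotP=> y; elim/squotP=> z.
by rewrite !squot_addE; apply/sclassP/sl_addA.
Qed.
Lemma squot_addC : commutative squot_add.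
Proof.
by elim/squotP=> x; elim/squotP=> y; rewrite !squot_addE; apply/sclassP/sl_addC.
Qed.
Lemma squot_add0 : left_id (sclass (sl_zero X)) squot_add.
Proof. by elim/squotP=> x; rewrite squot_addE; apply/sclassP/sl_add0. Qed.
Lemma squot_addN : left_inverse (sclass (sl_zero X)) squot_opp squot_add.
Proof.
by elim/squotP=> x; rewrite squot_oppE squot_addE; apply/sclassP/sl_addN.
Qed.

HB.instance Definition _ :=
  GRing.isZmodule.Build squot squot_addA squot_addC squot_add0 squot_addN.

Lemma sclassD x y : sclass (sl_add x y) = sclass x + sclass y.
Proof. by rewrite [RHS]squot_addE. Qed.

Lemma squot_scaleA a b u :
  squot_scale a (squot_scale b u) = squot_scale (a * b) u.
Proof.
by elim/squotP: u => x; rewrite !squot_scaleE; apply/sclassP/sl_scaleA.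
Qed.
Lemma squot_scale1 : left_id 1 squot_scale.
Proof. by elim/squotP=> x; rewrite squot_scaleE; apply/sclassP/sl_scale1. Qed.
Lemma squot_scaleDr : right_distributive squot_scale +%R.
Proof.
move=> a; elim/squotP=> x; elim/squotP=> y.
by rewrite -sclassD !squot_scaleE -sclassD; apply/sclassP/sl_scaleDr.
Qed.
Lemma squot_scaleDl u : {morph squot_scale^~ u : a b / a + b}.
Proof.
elim/squotP: u => x a b.
by rewrite !squot_scaleE -sclassD; apply/sclassP/sl_scaleDl.
Qed.

HB.instance Definition _ := GRing.Zmodule_isLmodule.Build K squot
  squot_scaleA squot_scale1 squot_scaleDr squot_scaleDl.

Lemma sclassZ k x : sclass (sl_scale k x) = k *: sclass x.
Proof. by rewrite [RHS]squot_scaleE. Qed.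

End SetoidQuotient.

(* Tensor product over K: formal sums of pairs, two of which are identified
   when every bilinear map takes the same value on them. *)

Definition bilinear_map (K : fieldType) (V W N : lmodType K)
    (phi : V -> W -> N) : Prop :=
  (forall k v v' w, phi (k *: v + v') w = k *: phi v w + phi v' w) /\
  (forall k v w w', phi v (k *: w + w') = k *: phi v w + phi v w').

Section Tensor.
Variables (K : fieldType) (V W : lmodType K).

Definition tens_eval (N : zmodType) (phi : V -> W -> N) (s : seq (V * W)) : N :=
  \sum_(x <- s) phi x.1 x.2.

Definition tens_eq (s t : seq (V * W)) : Prop :=
  forall (N : lmodType K) (phi : V -> W -> N), bilinear_map phi ->
    tens_eval phi s = tens_eval phi t.

Definition tens_scale (k : K) (s : seq (V * W)) := [seq (k *: x.1, x.2) | x <- s].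

Lemma tens_eval_cat (N : zmodType) (phi : V -> W -> N) s t :
  tens_eval phi (s ++ t) = tens_eval phi s + tens_eval phi t.
Proof. exact: big_cat. Qed.

Lemma bilinear_mapZl (N : lmodType K) (phi : V -> W -> N) k v w :
  bilinear_map phi -> phi (k *: v) w = k *: phi v w.
Proof.
move=> [h _]; have h0 : phi 0 w = 0.
  by have := h (-1) 0 0 w; rewrite scaler0 addr0 scaleN1r addNr.
by rewrite -[k *: v]addr0 h h0 addr0.
Qed.

Lemma tens_eval_scale (N : lmodType K) (phi : V -> W -> N) k s :
  bilinear_map phi -> tens_eval phi (tens_scale k s) = k *: tens_eval phi s.
Proof.
move=> h; rewrite /tens_eval big_map scaler_sumr.
by apply: eq_bigr => x _; rewrite bilinear_mapZl.
Qed.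

Definition tens_setoid : setoid_lmod K.
Proof.
refine (@SetoidLmod K (seq (V * W)) tens_eq [::] (tens_scale (-1)) cat
  tens_scale _ _ _ _ _ _ _ _ _ _ _ _ _ _).
- by [].
- by move=> s t h N phi hp; rewrite h.
- by move=> s t r h h' N phi hp; rewrite h // h'.
- by move=> s t h N phi hp; rewrite !tens_eval_scale ?h.
- by move=> s s' t t' h h' N phi hp; rewrite !tens_eval_cat h ?h'.
- by move=> k s t h N phi hp; rewrite !tens_eval_scale ?h.
- by move=> s t r N phi hp; rewrite catA.
- by move=> s t N phi hp; rewrite !tens_eval_cat addrC.
- by [].
- move=> s N phi hp; rewrite tens_eval_cat tens_eval_scale // scaleN1r addNr.
  by rewrite /tens_eval big_nil.
- by move=> a b s N phi hp; rewrite !tens_eval_scale // scalerA.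
- by move=> s N phi hp; rewrite !tens_eval_scale // scale1r.
- move=> a s t N phi hp.
  by rewrite tens_eval_cat !tens_eval_scale // tens_eval_cat scalerDr.
- by move=> a b s N phi hp; rewrite tens_eval_cat !tens_eval_scale // scalerDl.
Defined.

Definition tens := squot tens_setoid.
HB.instance Definition _ := GRing.Lmodule.on tens.

Definition tpure (v : V) (w : W) : tens := sclass (X := tens_setoid) [:: (v, w)].

(* The linear map on [tens] induced by a bilinear [phi]. *)
Definition tlift (N : zmodType) (phi : V -> W -> N) (u : tens) : N :=
  tens_eval phi (srepr u).

Lemma tlift_class (N : lmodType K) (phi : V -> W -> N) (s : seq (V * W)) :
  bilinear_map phi ->
  tlift phi (sclass (X := tens_setoid) s) = tens_eval phi s.
Proof. exact: (srepr_class (X := tens_setoid) s). Qed.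

Lemma tlift_pure (N : lmodType K) (phi : V -> W -> N) v w :
  bilinear_map phi -> tlift phi (tpure v w) = phi v w.
Proof. by move=> h; rewrite tlift_class // /tens_eval big_seq1. Qed.

Lemma tlift_linear (N : lmodType K) (phi : V -> W -> N) k u v :
  bilinear_map phi -> tlift phi (k *: u + v) = k *: tlift phi u + tlift phi v.
Proof.
move=> h; rewrite -(sreprK u) -(sreprK v) -sclassZ -sclassD !tlift_class //=.
by rewrite tens_eval_cat tens_eval_scale.
Qed.

Lemma tpure_bilinear : bilinear_map tpure.
Proof.
split=> [k v v' w|k v w w']; rewrite -sclassZ -sclassD; apply/sclassP => N phi hp;
  by rewrite /tens_eval !big_cons !big_nil !addr0 /=;
     case: (hp) => h1 h2; rewrite bilinear_mapZl // (h1, h2).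
Qed.

Lemma tens_sum_pure (u : tens) : u = \sum_(x <- srepr u) tpure x.1 x.2.
Proof.
rewrite -[LHS]sreprK; elim: (srepr u : seq _) => [|[v w] s IH].
  by rewrite big_nil.
by rewrite big_cons -IH -sclassD.
Qed.

End Tensor.

(* The operations of a Lie-Rinehart algebra over A, without its axioms: the
   complex below is written in terms of the operations alone. *)

Record lr_alg (K : fieldType) (A : comAlgType K) := LRAlg {
  lr_car :> lmodType K;
  lr_smul : A -> lr_car -> lr_car;
  lr_bracket : lr_car -> lr_car -> lr_car;
  lr_anchor : lr_car -> A -> A }.

Section Complex.
Variables (K : fieldType) (A : comAlgType K).

Definition lr_tens (L : lr_alg A) : lr_alg A := {|
  lr_car := tens A L;
  lr_smul := fun c => tlift (fun a X => tpure (c * a) X);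
  lr_bracket := fun u v =>
    tlift (fun a X => tlift (fun b Y =>
      tpure (a * b) (lr_bracket X Y)
      + tpure (a * lr_anchor X b) Y
      - tpure (b * lr_anchor Y a) X) v) u;
  lr_anchor := fun u b => tlift (fun a X => a * lr_anchor X b) u |}.

Variable L : lr_alg A.

Fixpoint lr_pow (p : nat) : lr_alg A :=
  if p is p'.+1 then lr_tens (lr_pow p') else L.

(* [face i] multiplies the entries i and i+1 of a_0 (x) ... (x) a_p (x) X for
   i < p (the map m_i), and for i = p it multiplies a_p into X (the map e). *)
Fixpoint face (p : nat) : nat -> lr_pow p.+1 -> lr_pow p :=
  match p return nat -> lr_pow p.+1 -> lr_pow p with
  | 0 => fun _ => tlift (fun (a : A) (X : L) => lr_smul a X)
  | p'.+1 => fun i =>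
    if i is i'.+1 then tlift (fun (a : A) (u : lr_pow p'.+1) =>
                                tpure a (face i' u))
    else tlift (fun (a : A) (u : lr_pow p'.+1) =>
           tlift (fun (b : A) (w : lr_pow p') => tpure (a * b) w) u)
  end.

(* [c p us] is the value at us = [:: u_1; ...; u_q] of the component in C^{pq},
   where q = size us, so that a function [seq (lr_pow p) -> A] packs the
   components (p, q) for all q. The coefficient module is A, on which
   a_1 (x) ... (x) a_p (x) X acts by its anchor. *)
Definition bicochain : Type := forall p : nat, seq (lr_pow p) -> A.

Definition multilinear (V : lmodType K) (f : seq V -> A) : Prop :=
  forall us vs k u v, f (us ++ (k *: u + v) :: vs)
    = k *: f (us ++ u :: vs) + f (us ++ v :: vs).

Definition alternating (V : lmodType K) (f : seq V -> A) : Prop :=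
  forall us vs ws u, f (us ++ u :: vs ++ u :: ws) = 0.

Definition cochain (n : nat) (c : bicochain) : Prop :=
  (forall p, multilinear (c p) /\ alternating (c p)) /\
  (forall p us, (p + size us)%N != n -> c p us = 0).

Definition omit (T : Type) (i : nat) (s : seq T) : seq T :=
  take i s ++ drop i.+1 s.

(* Positions are counted from 0, which changes the sign (-1)^(i-1) to (-1)^i
   and leaves (-1)^(j+k) unchanged. *)
Definition chevalley_eilenberg (M : lr_alg A) (f : seq M -> A) (us : seq M) : A :=
  \sum_(i < size us) (-1) ^+ i * lr_anchor us`_i (f (omit i us))
  + \sum_(k < size us) \sum_(j < k)
      (-1) ^+ (j + k) * f (lr_bracket us`_j us`_k :: omit j (omit k us)).

(* delta : C^{p,q-1} -> C^{p,q}, and 0 in C^{p,0} *)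
Definition d_vert (M : lr_alg A) (f : seq M -> A) (us : seq M) : A :=
  (-1) ^+ size us * (if us is [::] then 0 else chevalley_eilenberg f us).

(* the multilinear map with
   a_1 (x) w_1, ..., a_q (x) w_q |-> a_1 ... a_q f(w_1, ..., w_q) *)
Fixpoint scalar_ext (W : lmodType K) (f : seq W -> A) (us : seq (tens A W)) : A :=
  if us is u :: us' then
    tlift (fun (a : A) (w : W) => a * scalar_ext (fun ws => f (w :: ws)) us') u
  else f [::].

Definition d_hor (p : nat) (f : seq (lr_pow p) -> A) (us : seq (lr_pow p.+1)) : A :=
  scalar_ext f us
  + \sum_(i < p.+1) (-1) ^+ i.+1 * f [seq face i u | u <- us].

(* differential d + (-1)^p delta of the total complex *)
Definition d_tot (c : bicochain) : bicochain := fun p =>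
  match p return seq (lr_pow p) -> A with
  | 0 => fun us => d_vert (c 0%N) us
  | p'.+1 => fun us =>
      d_hor (c p') us + (-1) ^+ p'.+1 * d_vert (c p'.+1) us
  end.

(* Elements of H^{n+1} are represented by cosets modulo coboundaries, so that
   equality of classes is equality of sets. *)
Definition coh_class (n : nat) (c : bicochain) : set bicochain :=
  [set c' | exists2 b, cochain n b & forall p us, c' p us = c p us + d_tot b us].

End Complex.

Record lr_iso (K : fieldType) (A A' : comAlgType K)
    (L : lr_alg A) (L' : lr_alg A') := LRIso {
  iso_ring : {lrmorphism A -> A'};
  iso_ring_inv : A' -> A;
  iso_ringK : cancel iso_ring iso_ring_inv;
  iso_ring_invK : cancel iso_ring_inv iso_ring;
  iso_lie : {linear L -> L'};
  iso_lie_inv : L' -> L;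
  iso_lieK : cancel iso_lie iso_lie_inv;
  iso_lie_invK : cancel iso_lie_inv iso_lie;
  iso_lie_smul : forall a X,
    iso_lie (lr_smul a X) = lr_smul (iso_ring a) (iso_lie X);
  iso_lie_bracket : forall X Y,
    iso_lie (lr_bracket X Y) = lr_bracket (iso_lie X) (iso_lie Y);
  iso_lie_anchor : forall X a,
    iso_ring (lr_anchor X a) = lr_anchor (iso_lie X) (iso_ring a) }.

Section Transport.
Variables (K : fieldType) (A A' : comAlgType K).
Variables (L : lr_alg A) (L' : lr_alg A') (phi : lr_iso L L').

Fixpoint iso_pow_inv (p : nat) : lr_pow L' p -> lr_pow L p :=
  match p return lr_pow L' p -> lr_pow L p with
  | 0 => iso_lie_inv phi
  | p'.+1 => tlift (fun (a : A') (u : lr_pow L' p') =>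
                      tpure (iso_ring_inv phi a) (iso_pow_inv u))
  end.

Definition iso_cochain (c : bicochain L) : bicochain L' :=
  fun p us => iso_ring phi (c p [seq iso_pow_inv u | u <- us]).

Definition iso_coh (E : set (bicochain L)) : set (bicochain L') :=
  iso_cochain @` E.

End Transport.

Section Center.
Variables (K : fieldType) (S : algType K).

Definition center_pred : {pred S} := fun a => `[< forall x, a * x = x * a >].

Lemma center_predP a : reflect (forall x, a * x = x * a) (a \in center_pred).
Proof. exact: asboolP. Qed.

Fact center_subalg : subalg_closed center_pred.
Proof.
split; first by apply/center_predP => x; rewrite mul1r mulr1.
- move=> k a b /center_predP ha /center_predP hb; apply/center_predP => x.
  by rewrite mulrDl mulrDr hb -scalerAl -scalerAr ha.
- move=> a b /center_predP ha /center_predP hb; apply/center_predP => x.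
  by rewrite -mulrA hb !mulrA ha.
Qed.

HB.instance Definition _ := GRing.isSubalgClosed.Build K S center_pred
  center_subalg.

Record center := Center { center_val :> S; _ : center_val \in center_pred }.

HB.instance Definition _ := [isSub for center_val].
HB.instance Definition _ := [Choice of center by <:].
HB.instance Definition _ := [SubChoice_isSubAlgebra of center by <:].

Lemma centerP (a : center) x : val a * x = x * val a.
Proof. by have /center_predP := valP a. Qed.

Fact center_mulC : commutative (@GRing.mul center).
Proof. by move=> a b; apply/val_inj; rewrite /= centerP. Qed.

HB.instance Definition _ := GRing.PzRing_hasCommutativeMul.Build center
  center_mulC.

End Center.

Section Derivations.
Variables (K : fieldType) (S : algType K).

Definition der_pred : {pred S -> S} := fun D =>
  `[< (forall k x y, D (k *: x + y) = k *: D x + D y) /\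
      (forall x y, D (x * y) = D x * y + x * D y) >].

Fact der_submod : submod_closed der_pred.
Proof.
split.
  apply/asboolP; split=> [k x y|x y].
    by rewrite -[LHS]/(0) -![(0 : S -> S) _]/0 scaler0 addr0.
  by rewrite -[LHS]/(0) -![(0 : S -> S) _]/0 mul0r mulr0 addr0.
move=> a D E /asboolP[D1 D2] /asboolP[E1 E2]; apply/asboolP; split=> [k x y|x y].
  rewrite -![(a *: D + E) _]/(a *: D _ + E _) D1 E1 !scalerDr !scalerA mulrC.
  by rewrite -!addrA; congr (_ + _); rewrite addrCA.
rewrite -![(a *: D + E) _]/(a *: D _ + E _) D2 E2 scalerDr mulrDl mulrDr.
by rewrite -scalerAl -scalerAr -!addrA; congr (_ + _); rewrite addrCA.
Qed.

HB.instance Definition _ := GRing.isSubmodClosed.Build K (S -> S) der_pred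
  der_submod.

Record der := Der { der_val :> S -> S; _ : der_val \in der_pred }.

HB.instance Definition _ := [isSub for der_val].
HB.instance Definition _ := [Choice of der by <:].
HB.instance Definition _ := [SubChoice_isSubLmodule of der by <:].

Lemma derP (D : der) (k : K) x y : D (k *: x + y) = k *: D x + D y.
Proof. by have /asboolP[] := valP D. Qed.

Lemma derM (D : der) x y : D (x * y) = D x * y + x * D y.
Proof. by have /asboolP[] := valP D. Qed.

Lemma derD (D : der) x y : D (x + y) = D x + D y.
Proof. by rewrite -{1}[x]scale1r derP scale1r. Qed.

Lemma der0 (D : der) : D 0 = 0.
Proof. by apply: (addrI (D 0)); rewrite -derD !addr0. Qed.

Lemma derZ (D : der) k x : D (k *: x) = k *: D x.
Proof. by rewrite -[k *: x]addr0 derP der0 addr0. Qed.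

Lemma derN (D : der) x : D (- x) = - D x.
Proof. by rewrite -!scaleN1r derZ. Qed.

Fact der_bracket_subproof (D E : der) :
  (fun x => D (E x) - E (D x)) \in der_pred.
Proof.
apply/asboolP; split=> [k x y|x y].
  by rewrite !derP scalerBr opprD -!addrA; congr (_ + _); rewrite addrCA.
rewrite !derM !derD !derM mulrBl mulrBr.
set a := D (E x) * y; set b := E x * D y; set c := D x * E y.
set d := x * D (E y); set e := E (D x) * y; set f := x * E (D y).
have -> : a + b + (c + d) = a + d + (c + b).
  by rewrite [c + d]addrC addrACA [b + c]addrC.
have -> : e + c + (b + f) = e + f + (c + b).
  by rewrite [b + f]addrC addrACA.
by rewrite opprD addrACA subrr addr0 opprD addrACA.
Qed.
Definition der_bracket (D E : der) : der := Der (der_bracket_subproof D E).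

Fact der_smul_subproof (a : center S) (D : der) : (fun x => val a * D x) \in der_pred.
Proof.
apply/asboolP; split=> [k x y|x y]; first by rewrite derP mulrDr -scalerAr.
by rewrite derM mulrDr !mulrA -(centerP a x).
Qed.
Definition der_smul (a : center S) (D : der) : der := Der (der_smul_subproof a D).

Fact ad_subproof (s : S) : (fun x => s * x - x * s) \in der_pred.
Proof.
apply/asboolP; split=> [k x y|x y].
  rewrite mulrDr mulrDl -scalerAl -scalerAr scalerBr opprD -!addrA.
  by congr (_ + _); rewrite addrCA.
by rewrite mulrBl mulrBr !mulrA addrA subrK.
Qed.
Definition ad (s : S) : der := Der (ad_subproof s).

Fact der_center_subproof (D : der) (a : center S) : D (val a) \in center_pred (S := S).
Proof.
apply/center_predP => x; have := congr1 D (centerP a x).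
by rewrite !derM centerP [in RHS]addrC => /addIr.
Qed.
Definition der_center (D : der) (a : center S) : center S :=
  Center (der_center_subproof D a).

Lemma ad_linear k s t : ad (k *: s + t) = k *: ad s + ad t.
Proof.
apply/val_inj/funext => x.
rewrite -[RHS]/(k *: ad s x + ad t x) /= mulrDl mulrDr -scalerAl -scalerAr.
by rewrite scalerBr opprD -!addrA; congr (_ + _); rewrite addrCA.
Qed.

Definition inner (D : der) : Prop := exists s, D = ad s.

Lemma inner_lin k D E : inner D -> inner E -> inner (k *: D + E).
Proof. by move=> [s ->] [t ->]; exists (k *: s + t); rewrite ad_linear. Qed.

Lemma inner0 : inner 0.
Proof.
exists 0; apply/val_inj/funext => x.
by rewrite -[LHS]/(0) /= mul0r mulr0 subr0.
Qed.

Lemma innerZ k D : inner D -> inner (k *: D).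
Proof. by move=> h; rewrite -[_ *: _]addr0; apply: inner_lin inner0. Qed.

Lemma innerD D E : inner D -> inner E -> inner (D + E).
Proof. by move=> h h'; rewrite -[D]scale1r; apply: inner_lin. Qed.

Definition HH1_setoid : setoid_lmod K.
Proof.
refine (@SetoidLmod K der (fun D E => inner (D - E)) 0 -%R +%R *:%R
  _ _ _ _ _ _ _ _ _ _ _ _ _ _).
- by move=> D; rewrite subrr; exact: inner0.
- by move=> D E h; rewrite -opprB -scaleN1r; exact: innerZ.
- by move=> D E F h h'; rewrite -(subrKA E); exact: innerD.
- by move=> D E h; rewrite -opprD -scaleN1r; exact: innerZ.
- by move=> D D' E E' h h'; rewrite opprD addrACA; exact: innerD.
- by move=> k D E h; rewrite -scalerBr; exact: innerZ.
- by move=> D E F; rewrite [D + (E + F)]addrA subrr; exact: inner0.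
- by move=> D E; rewrite [D + E]addrC subrr; exact: inner0.
- by move=> D; rewrite add0r subrr; exact: inner0.
- by move=> D; rewrite addNr subrr; exact: inner0.
- by move=> a b D; rewrite scalerA subrr; exact: inner0.
- by move=> D; rewrite scale1r subrr; exact: inner0.
- by move=> a D E; rewrite scalerDr subrr; exact: inner0.
- by move=> a b D; rewrite scalerDl subrr; exact: inner0.
Defined.

Definition HH1 := squot HH1_setoid.
HB.instance Definition _ := GRing.Lmodule.on HH1.

Definition HH1_class (D : der) : HH1 := sclass (X := HH1_setoid) D.
Definition HH1_repr (X : HH1) : der := srepr X.

Lemma HH1_classP D E : HH1_class D = HH1_class E <-> inner (D - E).
Proof. exact: (sclassP (X := HH1_setoid)). Qed.

Lemma HH1_reprK X : HH1_class (HH1_repr X) = X.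
Proof. exact: sreprK. Qed.

Lemma HH1_repr_class D : inner (HH1_repr (HH1_class D) - D).
Proof. exact: (srepr_class (X := HH1_setoid)). Qed.

Fact HH1_class_linear : linear HH1_class.
Proof. by move=> k D E; rewrite /HH1_class -sclassZ -sclassD. Qed.
HB.instance Definition _ := GRing.isLinear.Build K der HH1 *:%R HH1_class
  HH1_class_linear.

Definition HH1_lr : lr_alg (center S) := {|
  lr_car := HH1;
  lr_smul := fun a X => HH1_class (der_smul a (HH1_repr X));
  lr_bracket := fun X Y => HH1_class (der_bracket (HH1_repr X) (HH1_repr Y));
  lr_anchor := fun X => der_center (HH1_repr X) |}.

Lemma inner_smul a D : inner D -> inner (der_smul a D).
Proof.
move=> [s ->]; exists (val a * s); apply/val_inj/funext => x /=.
by rewrite mulrBr !mulrA (centerP a x).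
Qed.

Lemma HH1_smulE a D :
  lr_smul (a : center S) (HH1_class D : HH1_lr) = HH1_class (der_smul a D).
Proof.
apply/HH1_classP.
have -> : der_smul a (HH1_repr (HH1_class D)) - der_smul a D
  = der_smul a (HH1_repr (HH1_class D) - D).
  by apply/val_inj/funext => x; rewrite -[RHS]/(_ * (_ - _)) mulrBr.
exact/inner_smul/HH1_repr_class.
Qed.

Lemma der_bracketC D E : der_bracket D E = - der_bracket E D.
Proof. by apply/val_inj/funext => x; rewrite -[RHS]/(- (_ - _)) opprB. Qed.

Lemma der_bracketDl D D' E :
  der_bracket (D + D') E = der_bracket D E + der_bracket D' E.
Proof.
apply/val_inj/funext => x; rewrite -[RHS]/((_ - _) + (_ - _)) /=.
rewrite -[(val D + val D') x]/(D x + D' x) -[(val D + val D') (E x)]/(D (E x) + D' (E x)).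
by rewrite derD opprD addrACA.
Qed.

Lemma der_bracketDr D E E' :
  der_bracket D (E + E') = der_bracket D E + der_bracket D E'.
Proof.
by rewrite der_bracketC der_bracketDl opprD -!(der_bracketC D).
Qed.

Lemma der_bracket_ad D s : der_bracket D (ad s) = ad (D s).
Proof.
apply/val_inj/funext => x /=; rewrite derD derN !derM.
set a := D x * s; set b := x * D s; set c := s * D x; set d := D s * x.
by rewrite [a + b]addrC opprD addrACA addrK.
Qed.

Lemma inner_bracketl D E : inner D -> inner (der_bracket D E).
Proof.
move=> [s ->]; rewrite der_bracketC der_bracket_ad -scaleN1r.
by apply: innerZ; exists (E s).
Qed.

Lemma inner_bracketr D E : inner E -> inner (der_bracket D E).
Proof. by move=> [s ->]; rewrite der_bracket_ad; exists (D s). Qed.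

Lemma HH1_bracketE D E :
  lr_bracket (HH1_class D : HH1_lr) (HH1_class E) = HH1_class (der_bracket D E).
Proof.
apply/HH1_classP; set D' := HH1_repr _; set E' := HH1_repr (HH1_class E).
have hD : inner (D' - D) by exact: HH1_repr_class.
have hE : inner (E' - E) by exact: HH1_repr_class.
rewrite -{1}(subrK D D') der_bracketDl -{2}(subrK E E') der_bracketDr.
rewrite addrA addrK; apply: innerD; first exact: inner_bracketl.
exact: inner_bracketr.
Qed.

Lemma HH1_anchorE D a :
  lr_anchor (HH1_class D : HH1_lr) a = der_center D a.
Proof.
apply/val_inj => /=; have [s hs] := HH1_repr_class D.
have -> : HH1_repr (HH1_class D) = D + ad s by rewrite -hs addrC subrK.
by rewrite -[LHS]/(D (val a) + ad s (val a)) /= centerP subrr addr0.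
Qed.

End Derivations.

(* [ad_lift] stands for a K-linear section Im(ad) -> S of ad: it is constrained
   and used only on Im(ad), and its other values do not matter. *)
Record sections (K : fieldType) (S : algType K) := Sections {
  der_lift : {linear HH1 S -> der S};
  der_liftK : forall X, HH1_class (der_lift X) = X;
  ad_lift : der S -> S;
  ad_lift_linear : forall k D E, inner D -> inner E ->
    ad_lift (k *: D + E) = k *: ad_lift D + ad_lift E;
  ad_liftK : forall D, inner D -> ad (ad_lift D) = D }.

Section CanonicalClass.
Variables (K : fieldType) (S : algType K) (sec : sections S).
Local Notation A := (center S).
Local Notation L := (HH1_lr S).
Local Notation p := (der_lift sec).
Local Notation q := (ad_lift sec).

Definition sec_t (X Y : L) : S :=
  q (der_bracket (p X) (p Y) - p (lr_bracket X Y)).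

Definition sec_s : tens A L -> S :=
  tlift (fun (a : A) (X : L) => q (der_smul a (p X) - p (lr_smul a X))).

Definition canon_f (X Y Z : L) : S :=
  - (p X (sec_t Y Z) - p Y (sec_t X Z) + p Z (sec_t X Y)
     - sec_t (lr_bracket X Y) Z + sec_t (lr_bracket X Z) Y
     - sec_t (lr_bracket Y Z) X).

Definition canon_g (u v : lr_pow L 1) : S :=
  tlift (fun (a : A) (X : L) => tlift (fun (b : A) (Y : L) =>
    let u := tpure a X : lr_pow L 1 in
    let v := tpure b Y : lr_pow L 1 in
    val (a * b) * sec_t X Y - sec_t (lr_smul a X) (lr_smul b Y)
    - (p (lr_smul a X) (sec_s v) - p (lr_smul b Y) (sec_s u)
       - sec_s (lr_bracket u v) + (sec_s u * sec_s v - sec_s v * sec_s u))) v) u.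

Definition canon_h (u : lr_pow L 2) : S :=
  tlift (fun (a : A) (v : lr_pow L 1) => tlift (fun (b : A) (X : L) =>
    val a * sec_s (tpure b X) - sec_s (tpure (a * b) X)
    + sec_s (tpure a (lr_smul b X))) v) u.

Definition canon_val (n : nat) : seq (lr_pow L n) -> S :=
  match n return seq (lr_pow L n) -> S with
  | 0 => fun us => if us is [:: X; Y; Z] then canon_f X Y Z else 0
  | 1 => fun us => if us is [:: u; v] then canon_g u v else 0
  | 2 => fun us => if us is [:: u] then canon_h u else 0
  | _ => fun=> 0
  end.

(* The values of f, g and h lie in the center A of S, so the default value of
   [insubd] is never taken. *)
Definition canon_cocycle : bicochain L := fun n us => insubd 0 (canon_val us).

Definition canonical_class : set (bicochain L) := coh_class 2 canon_cocycle.

End CanonicalClass.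

(* Morita equivalence over K is a K-linear equivalence of the categories of left
   modules; K acts on the morphisms M -> N through k%:A. *)

Record lmod_functor (K : fieldType) (S R : algType K) := LmodFunctor {
  fun_ob :> lmodType S -> lmodType R;
  fun_map : forall M N : lmodType S, {linear M -> N} -> {linear fun_ob M -> fun_ob N};
  fun_map_id : forall (M : lmodType S) (f : {linear M -> M}),
    f =1 id -> fun_map f =1 id;
  fun_map_comp : forall (M N P : lmodType S)
      (f : {linear M -> N}) (g : {linear N -> P}) (h : {linear M -> P}),
    h =1 g \o f -> fun_map h =1 fun_map g \o fun_map f;
  fun_map_linear : forall (M N : lmodType S) (k : K) (f g h : {linear M -> N}),
    (forall x, h x = k%:A *: f x + g x) ->
    forall y, fun_map h y = k%:A *: fun_map f y + fun_map g y }.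

Record morita_equiv (K : fieldType) (S R : algType K) := MoritaEquiv {
  mor_fun : lmod_functor S R;
  mor_inv : lmod_functor R S;
  mor_unit : forall M : lmodType S, {linear M -> mor_inv (mor_fun M)};
  mor_unit_bij : forall M, bijective (mor_unit M);
  mor_unit_nat : forall (M N : lmodType S) (f : {linear M -> N}) x,
    mor_unit N (f x) = fun_map mor_inv (fun_map mor_fun f) (mor_unit M x);
  mor_counit : forall N : lmodType R, {linear mor_fun (mor_inv N) -> N};
  mor_counit_bij : forall N, bijective (mor_counit N);
  mor_counit_nat : forall (M N : lmodType R) (f : {linear M -> N}) y,
    mor_counit N (fun_map mor_fun (fun_map mor_inv f) y) = f (mor_counit M y) }.

Section MoritaInvariance.
Variables (K : fieldType) (S R : algType K) (E : morita_equiv S R).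

Definition rmul (s : S) (x : S^o) : S^o := x * s.

Fact rmul_linear s : linear (rmul s).
Proof. by move=> a x y; rewrite /rmul mulrDl -mulrA. Qed.
HB.instance Definition _ s := GRing.isLinear.Build S S^o S^o *:%R (rmul s)
  (rmul_linear s).

(* The R-S-bimodule attached to the equivalence: R acts on the left, and S on
   the right through the endomorphisms x |-> x s of S^o. *)
Definition mor_bimod : lmodType R := mor_fun E S^o.
Definition mor_act (y : mor_bimod) (s : S) : mor_bimod :=
  fun_map (mor_fun E) (rmul s) y.

(* Write P for this bimodule. The isomorphism HH^n(S) -> HH^n(R) is the one
   given by the maps
     Ext^n_{S-S}(S, S) -> Ext^n_{R-S}(P, P) <- Ext^n_{R-R}(R, R)
   obtained by applying P (x)_S - and - (x)_R P.

   n = 0: a and b have the same image if right multiplication by a and left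
   multiplication by b agree on P.

   n = 1: the class of a derivation D of S corresponds to the bimodule S + S
   with left action s(x, y) = (s x + D(s) y, s y), and similarly for R. The
   extensions of P by P obtained from D and from D' are isomorphic if and only
   if there is an additive map theta on P satisfying Leibniz's rule with respect
   to D' and D; theta is then automatically K-linear. *)
Definition HH0_corr (a : center S) (b : center R) : Prop :=
  forall y : mor_bimod, val b *: y = mor_act y (val a).

Definition HH1_corr (D : der S) (D' : der R) : Prop :=
  exists theta : mor_bimod -> mor_bimod,
  [/\ forall y z, theta (y + z) = theta y + theta z,
      forall r y, theta (r *: y) = D' r *: y + r *: theta y
    & forall y s, theta (mor_act y s) = mor_act (theta y) s + mor_act y (D s)].

(* These conditions determine phi, as every class in H^1 is some HH1_class D. *)
Definition canonical_iso (phi : lr_iso (HH1_lr S) (HH1_lr R)) : Prop :=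
  (forall a b, iso_ring phi a = b <-> HH0_corr a b) /\
  (forall D D', iso_lie phi (HH1_class D) = HH1_class D' <-> HH1_corr D D').

End MoritaInvariance.

(* Main.v *)
Require Import Defs.
From HB Require Import structures.
From mathcomp Require Import all_boot all_order all_algebra zify ring.
From mathcomp Require Import boolp classical_sets functions.

(* Let P be the R-S-bimodule of the equivalence. It is a progenerator, so that
   R = End_S(P) and S^op = End_R(P), and the triples (D', theta, D) with theta
   satisfying Leibniz's rule on P for D' in Der(R) and D in Der(S) form a crossed
   module with structure map (r, s) |-> (ad r, r . - . s, ad s) on R + S. Its
   kernel is the graph of the isomorphism of the centers, its cokernel is H^1,
   and both projections are maps of crossed modules.

   On cocycles: for given sections p_S, p_R there is a linear choice of operators
   nabla_X on P compatible with p_R(X) and p_S(X). The curvature of nabla and the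
   action of (t_R, t_S) on P differ by a bimodule endomorphism, that is by a
   central beta(X, Y); similarly the defect of A-linearity of nabla and the action
   of (s_R, s_S) differ by a central gamma(a (x) X). The Bianchi identity and its
   analogues for A (x) L and A (x) A (x) L then say that the two cocycles differ by
   the coboundary of (- beta, - gamma). Taking P = S and nabla = p_S, with
   beta = gamma = 0, the same identities show that the cocycles are central. *)

Set Implicit Arguments.
Unset Strict Implicit.
Unset Printing Implicit Defensive.

Import GRing.Theory.
Local Open Scope ring_scope.
Local Open Scope quotient_scope.

(** * Identities in abelian groups *)

(** The equivalence enters through two relations. Writing 1 in R as a sum of values f_i(x_i) of
    R-linear maps f_i on P makes P projective over S. The same relation for the inverse functor,
    carried back by F, is a dual basis of P over R. Each of them yields an explicit Grassmann
    connection on P, one lifting derivations of S and one lifting derivations of R.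

    The obstacle is that nabla_X has to be K-linear in X, since beta and gamma must be cochains;
    choosing a theta separately for every X is not enough. The Grassmann connection over S is given
    by a formula linear in D. It covers the wanted derivation of R only up to an inner one, and the
    section of ad on R removes this error linearly. In contrast, beta and gamma can be chosen value
    by value, because a central element is determined by its action on P.

    All comparisons are indexed by H^1(R), with the data of S pulled back along the inverse
    isomorphism, because this is where transported cochains are evaluated. *)

Inductive zexp := ZVar of nat | ZAdd of zexp & zexp | ZOpp of zexp | ZZero.

Section ZmodReflection.
Variable V : zmodType.

Fixpoint zeval (env : seq V) (e : zexp) : V :=
  match e with
  | ZVar i => env`_i
  | ZAdd e1 e2 => zeval env e1 + zeval env e2
  | ZOpp e1 => - zeval env e1
  | ZZero => 0
  end.

Fixpoint zcoef (e : zexp) (i : nat) : int :=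
  match e with
  | ZVar j => (i == j)%:Z
  | ZAdd e1 e2 => zcoef e1 i + zcoef e2 i
  | ZOpp e1 => - zcoef e1 i
  | ZZero => 0
  end.

Lemma zevalE env e : zeval env e = \sum_(i < size env) env`_i *~ zcoef e i.
Proof.
elim: e => [j|e1 IH1 e2 IH2|e IH|] /=.
- case: (ltnP j (size env)) => h.
    rewrite (bigD1 (Ordinal h)) //= eqxx big1 ?addr0 ?mulr1z // => i.
    by rewrite -val_eqE /= => /negbTE->.
  rewrite nth_default // big1 // => i _.
  by rewrite (_ : (val i == j) = false) //; apply/ltn_eqF/(leq_trans (ltn_ord i)).
- by rewrite IH1 IH2 -big_split; apply: eq_bigr => i _; rewrite mulrzDr.
- by rewrite IH -sumrN; apply: eq_bigr => i _; rewrite mulrNz.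
- by rewrite big1.
Qed.

(** Soundness of [zmod]. The test involves closed integers only, so it computes for an abstract [V].
    It serves modules and noncommutative algebras, where [ring] does not apply. *)
Lemma zmod_reflect env e1 e2 :
  all (fun i => zcoef e1 i == zcoef e2 i) (iota 0 (size env)) ->
  zeval env e1 = zeval env e2.
Proof.
move=> /allP h; rewrite !zevalE; apply: eq_bigr => i _.
by rewrite (eqP (h _ _)) // mem_iota ltn_ord.
Qed.

End ZmodReflection.

(* Atoms are compared up to unification: equal subterms may carry different
   canonical instances of the same operation. *)
Ltac zmod_index x env :=
  lazymatch env with
  | ?y :: ?env' =>
    match x with
    | _ => let _ := match constr:(Set) with _ => unify x y end in constr:(O)
    | _ => let i := zmod_index x env' in constr:(i.+1)
    end
  end.
Ltac zmod_add x env :=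
  match env with
  | _ => let i := zmod_index x env in env
  | _ => constr:(x :: env)
  end.
Ltac zmod_env e env :=
  lazymatch e with
  | ?a + ?b => let env' := zmod_env a env in zmod_env b env'
  | - ?a => zmod_env a env
  | 0 => env
  | ?x => zmod_add x env
  end.
Ltac zmod_quote e env :=
  lazymatch e with
  | ?a + ?b => let a' := zmod_quote a env in
               let b' := zmod_quote b env in constr:(ZAdd a' b')
  | - ?a => let a' := zmod_quote a env in constr:(ZOpp a')
  | 0 => constr:(ZZero)
  | ?x => let i := zmod_index x env in constr:(ZVar i)
  end.
Ltac zmod :=
  lazymatch goal with
  | |- @eq ?V ?a ?b =>
    let env := zmod_env a (@nil V) in
    let env := zmod_env b env in
    let a' := zmod_quote a env in
    let b' := zmod_quote b env in
    refine (@zmod_reflect _ env a' b' _); vm_compute; reflexivity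
  end.

(** * Modules *)

Section ModuleQuotient.
Variables (R : pzRingType) (V : lmodType R) (I : V -> Prop).
Hypotheses (I0 : I 0) (ID : forall x y, I x -> I y -> I (x + y)).
Hypothesis IZ : forall a x, I x -> I (a *: x).

Let IN x : I x -> I (- x). Proof. by rewrite -scaleN1r; apply: IZ. Qed.

Definition coset_rel : rel V := fun x y => `[< I (x - y) >].

Fact coset_rel_refl : reflexive coset_rel.
Proof. by move=> x; apply/asboolP; rewrite subrr. Qed.
Fact coset_rel_sym : symmetric coset_rel.
Proof. by move=> x y; apply/asboolP/asboolP => /IN; rewrite opprB. Qed.
Fact coset_rel_trans : transitive coset_rel.
Proof.
move=> y x z /asboolP xy /asboolP yz; apply/asboolP.
by rewrite -(subrKA y); apply: ID.
Qed.

Let coset_equiv := EquivRel coset_rel coset_rel_refl coset_rel_sym coset_rel_trans.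
Let Q := {eq_quot coset_equiv}.
Let pr (x : V) : Q := \pi_Q x.

Let prP x y : pr x = pr y <-> I (x - y).
Proof. by split=> [/eqmodP/asboolP //|xy]; apply/eqmodP/asboolP. Qed.

Let prK (u : Q) : pr (repr u) = u. Proof. exact: reprK. Qed.

Let reprP x : I (repr (pr x) - x). Proof. by apply/prP; rewrite prK. Qed.

Let add (u v : Q) := pr (repr u + repr v).
Let opp (u : Q) := pr (- repr u).
Let scale a (u : Q) := pr (a *: repr u).

Let addE x y : add (pr x) (pr y) = pr (x + y).
Proof. by apply/prP; rewrite opprD addrACA; apply: ID. Qed.
Let oppE x : opp (pr x) = pr (- x).
Proof. by apply/prP; rewrite -opprD; apply: IN. Qed.
Let scaleE a x : scale a (pr x) = pr (a *: x).
Proof. by apply/prP; rewrite -scalerBr; apply: IZ. Qed.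

Let QP (P : Q -> Prop) : (forall x, P (pr x)) -> forall u, P u.
Proof. by move=> h u; rewrite -(prK u). Qed.

Let addA : associative add.
Proof. by elim/QP=> x; elim/QP=> y; elim/QP=> z; rewrite !addE addrA. Qed.
Let addC : commutative add.
Proof. by elim/QP=> x; elim/QP=> y; rewrite !addE addrC. Qed.
Let add0 : left_id (pr 0) add.
Proof. by elim/QP=> x; rewrite addE add0r. Qed.
Let addN : left_inverse (pr 0) opp add.
Proof. by elim/QP=> x; rewrite oppE addE addNr. Qed.

HB.instance Definition _ := Choice.on Q.
HB.instance Definition _ := GRing.isZmodule.Build Q addA addC add0 addN.

Let scaleA a b u : scale a (scale b u) = scale (a * b) u.
Proof. by elim/QP: u => x; rewrite !scaleE scalerA. Qed.
Let scale1 : left_id 1 scale.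
Proof. by elim/QP=> x; rewrite scaleE scale1r. Qed.
Let scaleDr : right_distributive scale +%R.
Proof.
move=> a; elim/QP=> x; elim/QP=> y; rewrite -[pr x + pr y]/(add _ _) addE.
by rewrite !scaleE [RHS]addE -scalerDr.
Qed.
Let scaleDl u : {morph scale^~ u : a b / a + b}.
Proof.
elim/QP: u => x a b; rewrite -[_ + scale b _]/(add _ _) !scaleE addE.
by rewrite scalerDl.
Qed.

HB.instance Definition _ := GRing.Zmodule_isLmodule.Build R Q
  scaleA scale1 scaleDr scaleDl.

(** The witness is the quotient of V by I. The existential form hides its construction, as only a
    linear map with kernel I is wanted. *)
Lemma submodule_is_kernel :
  exists (N : lmodType R) (f : {linear V -> N}), forall x, f x = 0 <-> I x.
Proof.
have pr_lin : linear pr.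
  by move=> a x y; rewrite -[_ *: pr x]/(scale _ _) scaleE [RHS]addE.
pose L := GRing.isLinear.Build R V Q *:%R pr pr_lin.
pose f : {linear V -> Q} := HB.pack pr L.
by exists Q, f => x; rewrite -[X in _ <-> I X]subr0; apply: prP.
Qed.

End ModuleQuotient.

(** * Equivalences of module categories *)

Lemma linear_of (R : pzRingType) (M N : lmodType R) (f : M -> N) :
  linear f -> exists g : {linear M -> N}, g =1 f.
Proof.
move=> h; pose L := GRing.isLinear.Build R M N *:%R f h.
by pose g : {linear M -> N} := HB.pack f L; exists g.
Qed.

Lemma linear_inverse (R : pzRingType) (M N : lmodType R) (f : {linear M -> N}) :
  bijective f -> {g : {linear N -> M} | cancel f g /\ cancel g f}.
Proof.
move=> h; apply: cid; case: h => g fK gK.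
have [g' g'E] := linear_of (can2_linear fK gK).
by exists g'; split=> x; rewrite g'E.
Qed.

Section Functor.
Variables (K : fieldType) (S R : algType K) (F : lmod_functor S R).
Variables (M N : lmodType S).
Implicit Types f g h : {linear M -> N}.

Lemma fun_map_add f g h :
  (forall x, h x = f x + g x) ->
  forall y, fun_map F h y = fun_map F f y + fun_map F g y.
Proof.
move=> hE y; rewrite -[fun_map F f y]scale1r -[1]scale1r.
by apply: fun_map_linear => x; rewrite !scale1r.
Qed.

(** K-linearity with the coefficient 0: [f] is 0 times [f] plus [g] as soon as the values agree. No
    equality of packed linear maps is involved. *)
Lemma fun_map_eq f g : f =1 g -> fun_map F f =1 fun_map F g.
Proof.
move=> fg y; rewrite -[RHS]add0r -[0](scale0r (fun_map F f y)).
rewrite -[X in X *: _](scale0r 1).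
by apply: fun_map_linear => x; rewrite !scale0r add0r.
Qed.

Lemma fun_map0 h : (forall x, h x = 0) -> forall y, fun_map F h y = 0.
Proof.
move=> h0 y; apply: (addrI (fun_map F h y)); rewrite addr0.
by symmetry; apply: fun_map_add => x; rewrite h0 addr0.
Qed.

End Functor.

(** The linear maps from [R^o] to [M] are exactly these, so a functor carries the element [x] along
    as the image of [scale_at x]. *)
Definition scale_at (R : pzRingType) (M : lmodType R) (x : M) (a : R^o) : M := (a : R) *: x.

Fact scale_at_linear (R : pzRingType) (M : lmodType R) (x : M) : linear (scale_at x).
Proof. by move=> a b c; rewrite /scale_at scalerDl scalerA. Qed.
HB.instance Definition _ (R : pzRingType) (M : lmodType R) (x : M) :=
  GRing.isLinear.Build R R^o M *:%R (scale_at x) (scale_at_linear x).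

Section Inverse.
Variables (K : fieldType) (S R : algType K) (E : morita_equiv S R).

(** Unit and counit are inverted and exchanged. It is transparent so that [mor_fun (morita_sym E)]
    computes to [mor_inv E]. *)
Definition morita_sym : morita_equiv R S.
Proof.
pose u N := linear_inverse (mor_counit_bij E N).
pose c M := linear_inverse (mor_unit_bij E M).
refine (@MoritaEquiv K R S (mor_inv E) (mor_fun E)
  (fun N => sval (u N)) _ _ (fun M => sval (c M)) _ _).
- by move=> N; case: (svalP (u N)) => h1 h2; exists (mor_counit E N).
- move=> M N f x; case: (svalP (u N)) => h _; case: (svalP (u M)) => _ h'.
  by apply: (canLR h); rewrite mor_counit_nat h'.
- by move=> M; case: (svalP (c M)) => h1 h2; exists (mor_unit E M).
- move=> M N f y; case: (svalP (c N)) => h _; case: (svalP (c M)) => _ h'.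
  by apply: (canLR h); rewrite mor_unit_nat h'.
Defined.

End Inverse.

Section Equivalence.
Variables (K : fieldType) (S R : algType K) (E : morita_equiv S R).
Local Notation F := (mor_fun E).
Local Notation G := (mor_inv E).

Lemma mor_fun_faithful (M N : lmodType S) (f g : {linear M -> N}) :
  fun_map F f =1 fun_map F g -> f =1 g.
Proof.
move=> fg x; apply: (bij_inj (mor_unit_bij E N)).
rewrite (mor_unit_nat E f) (mor_unit_nat E g); exact: (fun_map_eq fg).
Qed.

Lemma mor_inv_faithful (M N : lmodType R) (f g : {linear M -> N}) :
  fun_map G f =1 fun_map G g -> f =1 g.
Proof.
move=> fg x; have [c [_ cK]] := linear_inverse (mor_counit_bij E M); rewrite -(cK x).
by rewrite -(mor_counit_nat f) -(mor_counit_nat g) (fun_map_eq fg).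
Qed.

(** The preimage is [G psi] conjugated by the unit. By naturality its image under G F agrees with
    [G psi], and G is faithful. *)
Lemma mor_fun_full (M N : lmodType S) (psi : {linear F M -> F N}) :
  exists f : {linear M -> N}, fun_map F f =1 psi.
Proof.
have [v [vK Kv]] := linear_inverse (mor_unit_bij E N).
have lf : linear (v \o fun_map G psi \o mor_unit E M) by exact: linearP.
have [f fE] := linear_of lf; exists f.
apply: mor_inv_faithful => z; case: (mor_unit_bij E M) => w _ wK.
by rewrite -(wK z) -mor_unit_nat fE /= Kv.
Qed.

(* Generator property: otherwise R modulo the trace ideal of P = F(S) is a
   nonzero module which receives no nonzero map from P through R. *)
Lemma trace_ideal1 :
  exists s : seq ({linear F S^o -> R^o} * F S^o), \sum_(x <- s) x.1 x.2 = 1.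
Proof.
pose I (r : R^o) := exists s : seq ({linear F S^o -> R^o} * F S^o),
  \sum_(x <- s) x.1 x.2 = r.
have [|||N [pi piE]] := @submodule_is_kernel R R^o I.
- by exists [::]; rewrite big_nil.
- by move=> x y [s <-] [t <-]; exists (s ++ t); rewrite big_cat.
- move=> a x [s <-]; exists [seq (x.1, a *: x.2) | x <- s].
  rewrite big_map scaler_sumr; apply: eq_bigr => i _ /=.
  by rewrite linearZ.
have pi0 (f : {linear F S^o -> R^o}) y : pi (f y) = 0.
  by apply/piE; exists [:: (f, y)]; rewrite big_seq1.
have [z zE] : exists z : {linear R^o -> N}, forall x, z x = 0.
  by exists (\0%R : {linear R^o -> N}).
suff /(_ 1) : pi =1 z by rewrite zE => /piE.
apply: mor_inv_faithful => x; rewrite (fun_map0 zE).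
(* An element [x] of G(R) is a map from S to G(R). Applying F to its composite with [G pi] and then
   the counit gives [pi] after a map from P to R, whose values lie in the trace ideal. *)
have [p pE] : exists p : {linear S^o -> G N}, p =1 fun_map G pi \o scale_at x.
  by apply: linear_of; exact: linearP.
have [o oE] : exists o : {linear S^o -> G N}, forall x, o x = 0.
  by exists (\0%R : {linear S^o -> G N}).
suff /(_ 1) : p =1 o by rewrite pE oE /= /scale_at scale1r.
apply: mor_fun_faithful => y; rewrite (fun_map0 oE).
apply: (bij_inj (mor_counit_bij E N)).
rewrite (fun_map_comp pE) /= mor_counit_nat linear0.
have [f fE] : exists f : {linear F S^o -> R^o},
    f =1 mor_counit E R^o \o fun_map F (scale_at x).
  by apply: linear_of; exact: linearP.
by rewrite -[X in pi X]fE pi0.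
Qed.

End Equivalence.

(** * Bimodules and derivations *)

(** Stated apart from equivalences because the regular bimodule is used too, in the proof that the
    cocycles are central. The carrier is only an R-module, so K acts through [k%:A], and [ractZr]
    makes the K-actions from the two sides agree. *)
Record bimod (K : fieldType) (S R : algType K) := Bimod {
  bimod_car :> lmodType R;
  ract : bimod_car -> S -> bimod_car;
  ractDl : forall y z s, ract (y + z) s = ract y s + ract z s;
  ractZl : forall r y s, ract (r *: y) s = r *: ract y s;
  ractDr : forall y s t, ract y (s + t) = ract y s + ract y t;
  ractZr : forall k y s, ract y (k *: s) = k%:A *: ract y s;
  ractM : forall y s t, ract y (s * t) = ract (ract y s) t;
  ract1 : forall y, ract y 1 = y }.

Definition regular_bimod (K : fieldType) (R : algType K) : bimod R R.
Proof.
refine (@Bimod K R R R^o (fun y s => (y : R) * s) _ _ _ _ _ _).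
- by move=> y z s; rewrite mulrDl.
- by move=> r y s; rewrite -mulrA.
- by move=> y s t; rewrite mulrDr.
- by move=> k y s; rewrite -scalerAr -[RHS]/(_ * _) -scalerAl mul1r.
- by move=> y s t; rewrite mulrA.
- by move=> y; rewrite mulr1.
Defined.

Section BimodTheory.
Variables (K : fieldType) (S R : algType K) (P : bimod S R).
Implicit Types (y z : P) (r : R) (s t : S).

Lemma ract0l s : ract (0 : P) s = 0.
Proof. by apply: (addrI (ract 0 s)); rewrite -ractDl !addr0. Qed.
Lemma ract0r y : ract y 0 = 0.
Proof. by apply: (addrI (ract y 0)); rewrite -ractDr !addr0. Qed.
Lemma ractNl y s : ract (- y) s = - ract y s.
Proof. by apply: (addrI (ract y s)); rewrite -ractDl !subrr ract0l. Qed.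
Lemma ractNr y s : ract y (- s) = - ract y s.
Proof. by apply: (addrI (ract y s)); rewrite -ractDr !subrr ract0r. Qed.
Lemma ract_suml (I : Type) (l : seq I) (F : I -> P) s :
  ract (\sum_(i <- l) F i) s = \sum_(i <- l) ract (F i) s.
Proof. by elim/big_rec2: _ => [|i x y _ <-]; rewrite ?ract0l ?ractDl. Qed.

Definition leibniz (D : der S) (D' : der R) (theta : P -> P) : Prop :=
  [/\ forall y z, theta (y + z) = theta y + theta z,
      forall r y, theta (r *: y) = D' r *: y + r *: theta y
    & forall y s, theta (ract y s) = ract (theta y) s + ract y (D s)].

Lemma leibniz0 (D : der S) (D' : der R) theta : leibniz D D' theta -> theta 0 = 0.
Proof. by case=> h _ _; apply: (addrI (theta 0)); rewrite -h !addr0. Qed.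
Lemma leibnizN D D' theta y : leibniz D D' theta -> theta (- y) = - theta y.
Proof.
by move=> h; apply: (addrI (theta y)); case: (h) => <- _ _; rewrite !subrr (leibniz0 h).
Qed.

Lemma leibniz_lin k D D' theta E E' eta :
  leibniz D D' theta -> leibniz E E' eta ->
  leibniz (k *: D + E) (k *: D' + E') (fun y => k%:A *: theta y + eta y).
Proof.
move=> [a1 a2 a3] [b1 b2 b3]; split.
- by move=> y z; rewrite a1 b1 scalerDr addrACA.
- move=> r y; rewrite a2 b2 -[(k *: D' + E') r]/(k *: D' r + E' r).
  by rewrite !scalerDr scalerDl !scalerA !mulr_algl !mulr_algr addrACA.
- move=> y s; rewrite a3 b3 -[(k *: D + E) s]/(k *: D s + E s).
  by rewrite !ractDl ractDr ractZl ractZr !scalerDr addrACA.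
Qed.

Lemma leibniz_ad r s : leibniz (ad s) (ad r) (fun y => r *: y - ract y s).
Proof.
split.
- by move=> y z; rewrite scalerDr ractDl opprD addrACA.
- by move=> t y; rewrite /= ractZl scalerBr scalerBl !scalerA; zmod.
- by move=> y t; rewrite /= ractDl ractNl ractZl -!ractM ractDr ractNr; zmod.
Qed.

Lemma leibniz_bracket D D' theta E E' eta :
  leibniz D D' theta -> leibniz E E' eta ->
  leibniz (der_bracket D E) (der_bracket D' E')
    (fun y => theta (eta y) - eta (theta y)).
Proof.
move=> h h'; case: (h) (h') => [a1 a2 a3] [b1 b2 b3]; split.
- by move=> y z; rewrite b1 a1 a1 b1 opprD addrACA.
- move=> r y; rewrite /= b2 a2 a1 b1 !a2 !b2 scalerBl scalerBr.
  zmod.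
- move=> y s; rewrite /= b3 a3 a1 b1 !a3 !b3 ractDl ractNl ractDr ractNr.
  zmod.
Qed.
End BimodTheory.

(** * Progenerator bimodules and the lifting of derivations *)

(** The first two fields identify the opposite algebra of S with the R-endomorphisms of P, the third
    says that P is finitely generated projective over R, the fourth that it is a generator. *)
Record morita_bimod (K : fieldType) (S R : algType K) (P : bimod S R) : Prop :=
  MoritaBimod {
    ract_full : forall f : {linear P -> P}, exists s, forall y, f y = ract y s;
    ract_faithful : forall s, (forall y : P, ract y s = 0) -> s = 0;
    dual_basis : exists l : seq ({linear P -> R^o} * P),
      forall y, \sum_(x <- l) (x.1 y : R) *: x.2 = y;
    trace_full : exists l : seq ({linear P -> R^o} * P),
      \sum_(x <- l) x.1 x.2 = 1 }.

Section MoritaBimod.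
Variables (K : fieldType) (S R : algType K) (P : bimod S R).
Hypothesis HP : morita_bimod P.
Implicit Types (y z : P) (r : R) (s t : S).

(** An r that kills P kills every value f(x) of a linear map from P to R, and 1 is a sum of such
    values. *)
Lemma lact_faithful r : (forall y, r *: y = 0) -> r = 0.
Proof.
move=> h; have [l l1] := trace_full HP; rewrite -[r]mulr1 -l1 mulr_sumr.
by apply: big1 => x _; rewrite -[_ * _]/(r *: (x.1 x.2 : R^o)) -linearZ h linear0.
Qed.

Lemma lact_inj r r' : (forall y, r *: y = r' *: y) -> r = r'.
Proof.
move=> h; apply/eqP; rewrite -subr_eq0; apply/eqP/lact_faithful => y.
by rewrite scalerBl h subrr.
Qed.

Lemma ract_inj s t : (forall y, ract y s = ract y t) -> s = t.
Proof.
move=> h; apply/eqP; rewrite -subr_eq0; apply/eqP/(ract_faithful HP) => y.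
by rewrite ractDr ractNr h subrr.
Qed.

Lemma ract_fullP (f : P -> P) :
  (forall y z, f (y + z) = f y + f z) -> (forall r y, f (r *: y) = r *: f y) ->
  exists s, forall y, f y = ract y s.
Proof.
move=> fD fZ; have [|g gE] := @linear_of R P P f; first by move=> r y z; rewrite fD fZ.
by have [s sE] := ract_full HP g; exists s => y; rewrite -gE.
Qed.

(** The pairing of the Morita context: the map x |-> f(x) y is an R-linear endomorphism of P, hence
    right multiplication by an element of S. *)
Lemma pairing_exists : exists br : {linear P -> R^o} -> P -> S,
  forall (f : {linear P -> R^o}) y x, (f x : R) *: y = ract x (br f y).
Proof.
have h (f : {linear P -> R^o}) : exists u : P -> S,
    forall y x, (f x : R) *: y = ract x (u y).
  suff /choice[u uE] y : exists s, forall x, (f x : R) *: y = ract x s by exists u.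
  apply: ract_fullP => [x z|r x]; first by rewrite linearD scalerDl.
  by rewrite linearZ scalerA.
have /choice[u uE] := h; exists u => f y x; exact: uE.
Qed.

(** Double centralizer property. If 1 is the sum of the f_i(x_i), then y is the sum of the x_i
    [f_i, y] with [f_i, y] in S. An S-linear f passes to the x_i, and reading the pairing backwards
    gives r as the sum of the f_i(f(x_i)). *)
Lemma lact_full (f : P -> P) :
  (forall y z, f (y + z) = f y + f z) ->
  (forall y s, f (ract y s) = ract (f y) s) ->
  exists r, forall y, f y = r *: y.
Proof.
move=> fD fS; have [br brE] := pairing_exists; have [l l1] := trace_full HP.
have f0 : f 0 = 0 by apply: (addrI (f 0)); rewrite -fD !addr0.
exists (\sum_(x <- l) (x.1 (f x.2) : R)) => y.
rewrite -{1}[y]scale1r -[1]l1 !scaler_suml.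
rewrite (big_morph f fD f0).
by apply: eq_bigr => x _; rewrite !brE fS.
Qed.

Lemma center_transportl (a : center S) :
  exists b : center R, forall y, val b *: y = ract y (val a).
Proof.
have [||r rE] := lact_full (f := fun y => ract y (val a)).
- by move=> y z; rewrite ractDl.
- by move=> y s; rewrite -!ractM centerP.
have rc : r \in center_pred (S := R).
  by apply/center_predP => t; apply: lact_inj => y; rewrite -!scalerA -!rE ractZl.
by exists (Center rc) => y; rewrite rE.
Qed.

Lemma center_transportr (b : center R) :
  exists a : center S, forall y, val b *: y = ract y (val a).
Proof.
have [||s sE] := ract_fullP (f := fun y => val b *: y).
- by move=> y z; rewrite scalerDr.
- by move=> r y; rewrite !scalerA centerP.
have sc : s \in center_pred (S := S).
  by apply/center_predP => t; apply: ract_inj => y; rewrite !ractM -!sE ractZl.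
by exists (Center sc) => y; rewrite sE.
Qed.

Lemma leibniz_derR (D : der S) (D1 D2 : der R) (theta : P -> P) :
  leibniz D D1 theta -> leibniz D D2 theta -> D1 = D2.
Proof.
move=> [_ h1 _] [_ h2 _]; apply/val_inj/funext => r; apply: lact_inj => y.
by apply: (addIr (r *: theta y)); rewrite -h1 -h2.
Qed.

(** When D' = ad r, the map theta - r is R-linear and thus right multiplication by some s. Right
    multiplications compose in reverse, hence D = ad (- s). *)
Lemma leibniz_innerS (D : der S) (D' : der R) (theta : P -> P) :
  leibniz D D' theta -> inner D' -> inner D.
Proof.
move=> [hD hR hS] [r D'E].
have [||s sE] := ract_fullP (f := fun y => theta y - r *: y).
- by move=> y z; rewrite hD scalerDr; zmod.
- move=> t y; rewrite hR D'E /= scalerBr scalerBl !scalerA; zmod.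
exists (- s); apply/val_inj/funext => t; apply: ract_inj => y /=.
have := sE (ract y t); rewrite hS.
rewrite mulNr mulrN opprK ractDr ractNr !ractM -!sE ractDl ractNl ractZl => <-.
zmod.
Qed.

Lemma leibniz_innerR (D : der S) (D' : der R) (theta : P -> P) :
  leibniz D D' theta -> inner D -> inner D'.
Proof.
move=> [hD hR hS] [s DE].
have [||r rE] := lact_full (f := fun y => theta y + ract y s).
- by move=> y z; rewrite hD ractDl; zmod.
- move=> y t; rewrite hS DE /= ractDr ractDl ractNr !ractM; zmod.
exists r; apply/val_inj/funext => t; apply: lact_inj => y /=.
rewrite scalerBl -!scalerA -!rE hR scalerDr ractZl; zmod.
Qed.

(** The Grassmann connection over S: the x_i and the functions [f_i, -] form a dual basis of P as a
    right S-module, and D is applied to the coordinates. The formula is K-linear in D. The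
    commutator of theta with the action of r is S-linear, so it is left multiplication by an element
    of R, and this element is [Delta D r]. *)
Lemma der_liftl : exists (theta : der S -> P -> P) (Delta : der S -> der R),
  (forall D, leibniz D (Delta D) (theta D)) /\
  (forall k D E y, theta (k *: D + E) y = k%:A *: theta D y + theta E y).
Proof.
have [br brE] := pairing_exists; have [l l1] := trace_full HP.
pose theta (D : der S) y := \sum_(x <- l) ract x.2 (D (br x.1 y)).
have brD f y z : br f (y + z) = br f y + br f z.
  by apply: ract_inj => x; rewrite ractDr -!brE scalerDr.
have brM f y s : br f (ract y s) = br f y * s.
  by apply: ract_inj => x; rewrite ractM -!brE ractZl.
have yE y : \sum_(x <- l) ract x.2 (br x.1 y) = y.
  rewrite -[RHS]scale1r -[1]l1 scaler_suml.
  by apply: eq_bigr => x _; rewrite brE.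
have thD D y z : theta D (y + z) = theta D y + theta D z.
  by rewrite -big_split; apply: eq_bigr => x _; rewrite brD derD ractDr.
have thS D y s : theta D (ract y s) = ract (theta D y) s + ract y (D s).
  rewrite -[y in ract y (D s)]yE !ract_suml -big_split.
  by apply: eq_bigr => x _; rewrite brM derM ractDr !ractM.
have thK D k y : theta D (k%:A *: y) = k%:A *: theta D y.
  rewrite scaler_sumr; apply: eq_bigr => x _.
  have -> : br x.1 (k%:A *: y) = k *: br x.1 y.
    by rewrite -[y in LHS]ract1 -ractZr brM mulr_algr.
  by rewrite derZ ractZr.
have /choice[Delta DeltaP] D : exists D' : der R, leibniz D D' (theta D).
  have h r : exists r', forall y, theta D (r *: y) - r *: theta D y = r' *: y.
    apply: lact_full => [y z|y s].
      by rewrite scalerDr !thD scalerDr; zmod.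
    rewrite -ractZl !thS ractDl ractNl !ractZl scalerDr; zmod.
  have [u uE] := choice h.
  have uD : u \in der_pred (S := R).
    apply/asboolP; split=> [k r r'|r r']; apply: lact_inj => y.
      rewrite -[k *: r]mulr_algl -[k *: u r]mulr_algl -uE !scalerDl thD -!scalerA.
      rewrite thK -!uE scalerBr; zmod.
    rewrite -uE scalerDl -!scalerA -!uE scalerBr; zmod.
  exists (Der uD); split=> // r y.
  by rewrite -[Der uD r *: y]uE subrK.
exists theta, Delta; split=> // k D E y.
rewrite scaler_sumr -big_split; apply: eq_bigr => x _.
by rewrite -ractZr -[RHS]ractDr.
Qed.

(** The mirror image of the previous construction: the Grassmann connection of the dual basis over
    R. *)
Lemma der_liftr (D' : der R) : exists (D : der S) (theta : P -> P), leibniz D D' theta.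
Proof.
have [l lE] := dual_basis HP.
pose theta y := \sum_(x <- l) D' (x.1 y : R) *: x.2.
have thD y z : theta (y + z) = theta y + theta z.
  by rewrite -big_split; apply: eq_bigr => x _; rewrite linearD derD scalerDl.
have thR r y : theta (r *: y) = D' r *: y + r *: theta y.
  rewrite -[in D' r *: y](lE y) !scaler_sumr -big_split.
  by apply: eq_bigr => x _; rewrite linearZ /= derM scalerDl !scalerA.
have h s : exists t, forall y, theta (ract y s) - ract (theta y) s = ract y t.
  apply: ract_fullP => [y z|r y].
    by rewrite !ractDl !thD ractDl; zmod.
  rewrite ractZl !thR ractDl !ractZl scalerBr; zmod.
have [u uE] := choice h.
have thK k y : theta (k%:A *: y) = k%:A *: theta y.
  rewrite scaler_sumr; apply: eq_bigr => x _.
  by rewrite linearZ /= scalerA -[k%:A *: x.1 y]/(k%:A * (x.1 y : R)) !mulr_algl derZ.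
have uD : u \in der_pred (S := S).
  apply/asboolP; split=> [k s t|s t]; apply: ract_inj => y.
    rewrite -uE !ractDr !ractZr thD thK -!uE scalerBr; zmod.
  rewrite -uE !ractDr !ractM -!uE ractDl ractNl; zmod.
exists (Der uD), theta; split=> // y s.
by rewrite -uE; zmod.
Qed.

End MoritaBimod.

Definition mor_bimodule (K : fieldType) (S R : algType K) (E : morita_equiv S R) : bimod S R.
Proof.
refine (@Bimod K S R (mor_bimod E) (@mor_act K S R E) _ _ _ _ _ _).
- by move=> y z s; exact: linearD.
- by move=> r y s; exact: linearZ.
- by move=> y s t; apply: fun_map_add => x; exact: mulrDr.
- move=> k y s; rewrite -[RHS]addr0.
  (* [fun_map_linear] expects a second summand, for which the zero map [rmul 0] is supplied. *)
  rewrite -(@fun_map0 _ _ _ (mor_fun E) _ _ (rmul 0) _ y); last by move=> x; exact: mulr0.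
  apply: fun_map_linear => x /=; rewrite /rmul mulr0 addr0.
  by rewrite -[RHS]/(k%:A * (x * s)) mulr_algl scalerAr.
- by move=> y s t; apply: fun_map_comp => x; exact: mulrA.
- by move=> y; apply: fun_map_id => x; exact: mulr1.
Defined.

Lemma mor_bimodule_morita (K : fieldType) (S R : algType K) (E : morita_equiv S R) :
  morita_bimod (mor_bimodule E).
Proof.
split.
- move=> f; have [g gE] := mor_fun_full (f : {linear mor_fun E S^o -> mor_fun E S^o}).
  exists (g 1) => y; rewrite -gE; apply: fun_map_eq => x.
  by rewrite -[x in LHS]mulr1 -[x * 1]/((x : S) *: (1 : S^o)) linearZ.
- move=> s s0; have : rmul s =1 rmul 0.
    apply: (@mor_fun_faithful _ _ _ E) => y; rewrite [RHS](fun_map0 (h := rmul 0)) ?s0 //.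
      exact: s0.
    by move=> x; exact: mulr0.
  by move=> /(_ 1); rewrite /rmul mul1r mulr0.
(* The generator property of G(R) gives 1 in S as a sum of f_i(z_i). Right multiplication by
   f_i(z_i) factors as S -> G(R) -> S through z_i and f_i. Applying F to the sum writes the identity
   of P as a sum of maps through F G(R), which is R by the counit. *)
- have [l l1] := trace_ideal1 (morita_sym E).
  have [c [cK Kc]] := linear_inverse (mor_counit_bij E R^o).
  pose g (z : mor_inv E R^o) : {linear mor_fun E S^o -> R^o} :=
    mor_counit E R^o \o fun_map (mor_fun E) (scale_at z).
  exists [seq (g x.2, fun_map (mor_fun E) x.1 (c 1)) | x <- l] => y.
  rewrite big_map -[RHS](ract1 (b := mor_bimodule E)) -l1.
  have -> : ract (y : mor_bimodule E) (\sum_(x <- l) x.1 x.2)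
    = \sum_(x <- l) ract (y : mor_bimodule E) (x.1 x.2).
    elim/big_rec2: _ => [|i x z _ <-]; rewrite ?ract0r //.
    exact: ractDr.
  apply: eq_bigr => x _; rewrite -linearZ -linearZ /=.
  have -> : c ((mor_counit E R^o (fun_map (mor_fun E) (scale_at x.2) y) : R) *: 1)
    = fun_map (mor_fun E) (scale_at x.2) y.
    by rewrite -[RHS]cK -[_ *: 1]/(_ * 1) mulr1.
  symmetry; apply: fun_map_comp => s.
  by rewrite /= linearZ.
- exact: trace_ideal1.
Qed.

(** * The canonical isomorphism of centers and of first cohomology *)

Section CanonicalIso.
Variables (K : fieldType) (S R : algType K) (P : bimod S R).
Hypothesis HP : morita_bimod P.

(** This and [der_corr] extend [HH0_corr] and [HH1_corr] to arbitrary bimodules, and are convertible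
    with them at [mor_bimodule E]. *)
Definition center_corr (a : center S) (b : center R) : Prop :=
  forall y : P, val b *: y = ract y (val a).

Definition der_corr (D : der S) (D' : der R) : Prop :=
  exists theta : P -> P, leibniz D D' theta.

Lemma center_corr_eq a b a' b' :
  center_corr a b -> center_corr a' b' -> a = a' <-> b = b'.
Proof.
move=> h h'; split=> e; apply/val_inj.
  by apply: (lact_inj HP) => y; rewrite h h' e.
by apply: (ract_inj HP) => y; rewrite -h -h' e.
Qed.

Lemma center_corr_lin k a b a' b' :
  center_corr a b -> center_corr a' b' -> center_corr (k *: a + a') (k *: b + b').
Proof.
move=> h h' y; rewrite ractDr ractZr -h -h' scalerDl; congr (_ + _).
by rewrite -[val _]mulr_algl scalerA.
Qed.

Lemma center_corrM a b a' b' :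
  center_corr a b -> center_corr a' b' -> center_corr (a * a') (b * b').
Proof. by move=> h h' y; rewrite ractM -h -h' !scalerA centerP. Qed.

Lemma center_corr1 : center_corr 1 1.
Proof. by move=> y; rewrite scale1r ract1. Qed.

(** Subtracting the two correspondences relates D - E to D' - E', and of two related derivations one
    is inner exactly when the other is. *)
Lemma der_corr_class D D' E E' :
  der_corr D D' -> der_corr E E' -> HH1_class D = HH1_class E <-> HH1_class D' = HH1_class E'.
Proof.
move=> [theta h] [eta h']; have l := leibniz_lin (-1) h' h.
rewrite !scaleN1r ![- _ + _]addrC in l; split=> /HH1_classP e; apply/HH1_classP.
  exact: leibniz_innerR l e.
exact: leibniz_innerS l e.
Qed.

(** The action of a pair (r, s) on P relates ad s to ad r for independent r and s, so each
    derivation can be moved within its class on its own. *)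
Lemma der_corr_shift D D' E E' : der_corr D D' ->
  HH1_class D = HH1_class E -> HH1_class D' = HH1_class E' -> der_corr E E'.
Proof.
move=> [theta h] /HH1_classP[s sE] /HH1_classP[r rE].
have l := leibniz_lin (-1) (leibniz_ad P r s) h.
rewrite -sE -rE !scaleN1r !opprB !subrK in l; by eexists; exact: l.
Qed.

Lemma der_corr_smul a b D D' : center_corr a b -> der_corr D D' ->
  der_corr (der_smul a D) (der_smul b D').
Proof.
move=> c [theta [h1 h2 h3]]; exists (fun y => val b *: theta y); split.
- by move=> y z; rewrite h1 scalerDr.
- by move=> r y; rewrite h2 scalerDr !scalerA (centerP b r).
- by move=> y s; rewrite h3 scalerDr /= ractM -c !ractZl.
Qed.

Lemma der_corr_bracket D D' E E' : der_corr D D' -> der_corr E E' ->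
  der_corr (der_bracket D E) (der_bracket D' E').
Proof. by move=> [th h] [et h']; eexists; apply: leibniz_bracket h h'. Qed.

Lemma der_corr_center D D' a b : der_corr D D' -> center_corr a b ->
  center_corr (der_center D a) (der_center D' b).
Proof.
move=> [th [h1 h2 h3]] c y; apply: (addIr (val b *: th y)); rewrite -h2 c h3 -c.
by rewrite addrC.
Qed.

(** Both relations are total on either side and respect equality in both directions, so choice turns
    them into bijections. Through [fE] and [uE] an equation between values becomes a correspondence,
    and correspondences are closed under all the operations. *)
Lemma canonical_iso_exists : exists phi : lr_iso (HH1_lr S) (HH1_lr R),
  (forall a b, iso_ring phi a = b <-> center_corr a b) /\
  (forall D D', iso_lie phi (HH1_class D) = HH1_class D' <-> der_corr D D').
Proof.
have /choice[f fP] : forall a, exists b, center_corr a b := center_transportl HP.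
have /choice[g gP] : forall b, exists a, center_corr a b := center_transportr HP.
have fE a b : f a = b <-> center_corr a b.
  by split=> [<- //|h]; have [e _] := center_corr_eq (fP a) h; rewrite e.
have fK : cancel f g by move=> a; have [_ e] := center_corr_eq (gP (f a)) (fP a); rewrite e.
have gK : cancel g f by move=> b; have [e _] := center_corr_eq (fP (g b)) (gP b); rewrite e.
have f_lin : linear f.
  by move=> k a b; apply/fE/center_corr_lin.
have f_mul : monoid_morphism f.
  by split=> [|a b]; apply/fE; [exact: center_corr1 | exact: center_corrM].
pose fL := GRing.isLinear.Build K (center S) (center R) *:%R f f_lin.
pose fM := GRing.isMonoidMorphism.Build (center S) (center R) f f_mul.
pose F : {lrmorphism center S -> center R} := HB.pack f fL fM.
have [theta [Delta [tP _]]] := der_liftl HP.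
have /choice[nabla nP] : forall D', exists D, der_corr D D' := der_liftr HP.
have dP D : der_corr D (Delta D) by exists (theta D).
pose u (X : HH1 S) : HH1 R := HH1_class (Delta (HH1_repr X)).
pose v (Y : HH1 R) : HH1 S := HH1_class (nabla (HH1_repr Y)).
have uE D D' : u (HH1_class D) = HH1_class D' <-> der_corr D D'.
  split=> [h|h]; first exact: der_corr_shift (dP _) (HH1_reprK _) h.
  by have [e _] := der_corr_class (dP (HH1_repr (HH1_class D))) h; rewrite [LHS]e ?HH1_reprK.
have HH1P (T : algType K) (X : HH1 T) : exists D, X = HH1_class D.
  by exists (HH1_repr X); rewrite HH1_reprK.
have uK : cancel u v.
  move=> X; have [D ->] := HH1P _ X.
  have [D' D'E] := HH1P _ (u (HH1_class D)); rewrite D'E.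
  have [_ e] := der_corr_class (nP (HH1_repr (HH1_class D'))) ((uE D D').1 D'E).
  by rewrite [LHS]e ?HH1_reprK.
have vK : cancel v u.
  move=> Y; have [D ->] := HH1P _ Y; apply/uE.
  exact: der_corr_shift (nP _) (erefl _) (HH1_reprK _).
have u_lin : linear u.
  move=> k X Y; have [D ->] := HH1P _ X; have [E ->] := HH1P _ Y.
  have [D' D'E] := HH1P _ (u (HH1_class D)); have [E' E'E] := HH1P _ (u (HH1_class E)).
  rewrite D'E E'E -!linearP; apply/uE.
  have [[th h] [et h']] := ((uE D D').1 D'E, (uE E E').1 E'E).
  by eexists; exact: leibniz_lin h h'.
pose uL := GRing.isLinear.Build K (HH1 S) (HH1 R) *:%R u u_lin.
pose U : {linear HH1_lr S -> HH1_lr R} := HB.pack u uL.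
have U_smul a X : U (lr_smul a X) = lr_smul (F a) (U X).
  have [D ->] := HH1P _ X; have [D' D'E] := HH1P _ (u (HH1_class D)).
  rewrite -[U (HH1_class D)]/(u _) D'E !HH1_smulE; apply/uE/der_corr_smul; first exact/fE.
  exact/uE.
have U_bracket X Y : U (lr_bracket X Y) = lr_bracket (U X) (U Y).
  have [D ->] := HH1P _ X; have [D' D'E] := HH1P _ (u (HH1_class D)).
  have [E ->] := HH1P _ Y; have [E' E'E] := HH1P _ (u (HH1_class E)).
  rewrite -[U (HH1_class D)]/(u _) -[U (HH1_class E)]/(u _) D'E E'E !HH1_bracketE.
  by apply/uE/der_corr_bracket; apply/uE.
have U_anchor X a : F (lr_anchor X a) = lr_anchor (U X) (F a).
  have [D ->] := HH1P _ X; have [D' D'E] := HH1P _ (u (HH1_class D)).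
  rewrite -[U (HH1_class D)]/(u _) D'E !HH1_anchorE.
  by apply/fE/der_corr_center; [apply/uE | apply/fE].
by exists (LRIso (iso_ring := F) fK gK (iso_lie := U) uK vK U_smul U_bracket U_anchor).
Qed.

End CanonicalIso.

(** The connection of [der_liftl] is linear but covers [Delta (p X)] instead of [p' X]. Both
    correspond to [p X], so they differ by an inner derivation of R. The section of ad lifts this
    difference linearly to [r X] in R, and subtracting the action of [r X] repairs the
    connection. *)
Lemma leibniz_lift (K : fieldType) (S R : algType K) (P : bimod S R) (L : lmodType K)
    (p : L -> der S) (p' : L -> der R) (sec : sections R) :
  morita_bimod P -> linear p -> linear p' ->
  (forall X, exists theta : P -> P, leibniz (p X) (p' X) theta) ->
  exists theta : L -> P -> P,
    (forall X, leibniz (p X) (p' X) (theta X)) /\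
    (forall k X Y y, theta (k *: X + Y) y = k%:A *: theta X y + theta Y y).
Proof.
move=> HP p_lin p'_lin h; have [theta [Delta [tP t_lin]]] := der_liftl HP.
have Delta_lin k D E : Delta (k *: D + E) = k *: Delta D + Delta E.
  apply: (leibniz_derR HP (tP _)).
  have -> : theta (k *: D + E) = fun y => k%:A *: theta D y + theta E y.
    by apply: funext => y; rewrite t_lin.
  exact: leibniz_lin (tP D) (tP E).
pose d X := Delta (p X) - p' X.
have d_lin k X Y : d (k *: X + Y) = k *: d X + d Y.
  by rewrite /d p_lin p'_lin Delta_lin scalerBr; zmod.
have dI X : inner (d X).
  have [eta hX] := h X; have := leibniz_lin (-1) hX (tP (p X)).
  rewrite !scaleN1r ![- _ + _]addrC => /(leibniz_innerR HP).
  by apply; rewrite subrr; exact: inner0.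
pose r X := ad_lift sec (d X).
exists (fun X y => theta (p X) y - r X *: y); split=> [X|k X Y y].
  have := leibniz_lin (-1) (leibniz_ad P (r X) 0) (tP (p X)).
  have -> : ad (r X) = d X by exact: ad_liftK.
  rewrite (_ : -1 *: ad 0 + p X = p X); last first.
    apply/val_inj/funext => x; rewrite -[LHS]/(-1 *: (0 * x - x * 0) + p X x).
    by rewrite mul0r mulr0 subrr scaler0 add0r.
  rewrite scaleN1r opprB subrK => [[h1 h2 h3]].
  have e y : (-1)%:A *: (r X *: y - ract y 0) + theta (p X) y = theta (p X) y - r X *: y.
    by rewrite ract0r subr0 scaleN1r scaleNr scale1r addrC.
  split; first by move=> y z; have := h1 y z; rewrite !e.
    by move=> t y; have := h2 t y; rewrite !e.
  by move=> y s; have := h3 y s; rewrite !e.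
rewrite p_lin t_lin /r d_lin ad_lift_linear // scalerDl scalerBr scalerA mulr_algl.
zmod.
Qed.

(** * Tensor products and Lie-Rinehart operations *)

Section Bilinear.
Variable K : fieldType.
Implicit Types V W N : lmodType K.

Lemma bilinear_l V W N (phi : V -> W -> N) w : bilinear_map phi -> linear (phi^~ w).
Proof. by move=> [h _] k u v; exact: h. Qed.

Lemma bilinear_r V W N (phi : V -> W -> N) v : bilinear_map phi -> linear (phi v).
Proof. by move=> [_ h] k u w; exact: h. Qed.

Lemma linear_fun0 V N (f : V -> N) : linear f -> f 0 = 0.
Proof. by move=> /(_ (-1) 0 0); rewrite scaler0 addr0 scaleN1r addNr. Qed.

Lemma linear_funD V N (f : V -> N) u v : linear f -> f (u + v) = f u + f v.
Proof. by move=> h; rewrite -[u]scale1r h !scale1r. Qed.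

Lemma linear_funN V N (f : V -> N) u : linear f -> f (- u) = - f u.
Proof. by move=> h; rewrite -[- u]addr0 -scaleN1r h linear_fun0 // addr0 scaleN1r. Qed.

Lemma linear_comp V W N (f : W -> N) (g : V -> W) :
  linear f -> linear g -> linear (fun v => f (g v)).
Proof. by move=> h h' k u v; rewrite h' h. Qed.

Lemma linear_add V N (f g : V -> N) :
  linear f -> linear g -> linear (fun v => f v + g v).
Proof. by move=> h h' k u v; rewrite h' h scalerDr addrACA. Qed.

Lemma linear_opp V N (f : V -> N) : linear f -> linear (fun v => - f v).
Proof. by move=> h k u v; rewrite h scalerN opprD. Qed.

Lemma bilinearI V W N (phi : V -> W -> N) :
  (forall w, linear (phi^~ w)) -> (forall v, linear (phi v)) -> bilinear_map phi.
Proof. by move=> h h'; split=> [k v v' w|k v w w']; [exact: h | exact: h']. Qed.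

Lemma bilinear_swap V W N (phi : V -> W -> N) :
  bilinear_map phi -> bilinear_map (fun w v => phi v w).
Proof. by case. Qed.

Lemma bilinear_add V W N (phi psi : V -> W -> N) :
  bilinear_map phi -> bilinear_map psi -> bilinear_map (fun v w => phi v w + psi v w).
Proof.
by move=> [h1 h2] [h3 h4]; split=> k *; rewrite (h1, h2) (h3, h4) scalerDr addrACA.
Qed.

Lemma bilinear_opp V W N (phi : V -> W -> N) :
  bilinear_map phi -> bilinear_map (fun v w => - phi v w).
Proof. by move=> [h1 h2]; split=> k *; rewrite (h1, h2) opprD scalerN. Qed.

Lemma bilinear_post V W N N' (phi : V -> W -> N) (f : N -> N') :
  bilinear_map phi -> linear f -> bilinear_map (fun v w => f (phi v w)).
Proof. by move=> [h1 h2] h; split=> k *; rewrite (h1, h2) h. Qed.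

Lemma bilinear_pre V W V' W' N (phi : V' -> W' -> N) (f : V -> V') (g : W -> W') :
  bilinear_map phi -> linear f -> linear g -> bilinear_map (fun v w => phi (f v) (g w)).
Proof. by move=> [h1 h2] hf hg; split=> k *; rewrite (hf, hg) (h1, h2). Qed.

Lemma bilinear_mul (A : algType K) : bilinear_map (fun a b : A => a * b).
Proof. by split=> k *; rewrite ?mulrDl ?mulrDr -?scalerAl -?scalerAr. Qed.

Lemma linear_id V : linear (fun v : V => v).
Proof. by []. Qed.

Lemma tens_ind V W (Q : tens V W -> Prop) :
  (forall u v, Q u -> Q v -> Q (u + v)) -> (forall v w, Q (tpure v w)) -> forall u, Q u.
Proof.
move=> hD hp u; rewrite (tens_sum_pure u); elim: (srepr u : seq _) => [|x s IH].
  rewrite big_nil -(linear_fun0 (bilinear_l 0 (tpure_bilinear V W))); exact: hp.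
by rewrite big_cons; apply: hD.
Qed.

Lemma tlift_lin V W N (phi : V -> W -> N) : bilinear_map phi -> linear (tlift phi).
Proof. by move=> h k u v; exact: tlift_linear. Qed.

(* No linearity of the inner functions is needed here: [tlift] is by definition
   a sum over a representative, which is taken once for all of them. *)
Lemma tlift_param (V W V' N : lmodType K) (Phi : V' -> V -> W -> N) u :
  (forall v w, linear (fun x => Phi x v w)) -> linear (fun x => tlift (Phi x) u).
Proof.
move=> h k x y; rewrite /tlift /tens_eval scaler_sumr -big_split.
by apply: eq_bigr => i _; exact: h.
Qed.

Section TwoTensors.
Variables (V W V' W' N : lmodType K) (Phi : V -> W -> V' -> W' -> N).
Hypothesis Phi1 : forall v w, bilinear_map (Phi v w).
Hypothesis Phi2 : forall v' w', bilinear_map (fun v w => Phi v w v' w').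

Lemma tlift2_bilinear_in u' : bilinear_map (fun v w => tlift (Phi v w) u').
Proof.
apply: bilinearI => [w|v].
  by apply: tlift_param => v' w'; exact: (bilinear_l w (Phi2 v' w')).
by apply: tlift_param => v' w'; exact: (bilinear_r v (Phi2 v' w')).
Qed.

(** The bracket of [lr_tens] and [canon_g] have this nested form. Linearity in [u] is the universal
    property of the outer tensor product; linearity in [u'] holds term by term over the
    representative of [u]. *)
Lemma tlift2_bilinear :
  bilinear_map (fun u u' => tlift (fun v w => tlift (Phi v w) u') u).
Proof.
apply: bilinearI => [u'|u]; first exact/tlift_lin/tlift2_bilinear_in.
move=> k x y; rewrite /= /tlift /tens_eval scaler_sumr -big_split.
by apply: eq_bigr => i _; exact: tlift_lin.
Qed.

Lemma tlift2_pure v w v' w' :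
  tlift (fun v w => tlift (Phi v w) (tpure v' w')) (tpure v w) = Phi v w v' w'.
Proof. by rewrite tlift_pure ?tlift_pure //; exact: tlift2_bilinear_in. Qed.
End TwoTensors.

End Bilinear.

(** An [lr_alg] carries no axioms. Bilinearity lets the operations of [lr_tens] be evaluated on pure
    tensors, and it is inherited by all [lr_pow]. *)
Record lr_bilinear (K : fieldType) (A : comAlgType K) (L : lr_alg A) : Prop :=
  LRBilinear {
    lr_smul_bilin : bilinear_map (@lr_smul K A L);
    lr_bracket_bilin : bilinear_map (@lr_bracket K A L);
    lr_anchor_bilin : bilinear_map (@lr_anchor K A L) }.

Section LRTensBilinear.
Variables (K : fieldType) (A : comAlgType K) (L : lr_alg A).
Hypothesis HL : lr_bilinear L.
Let br := lr_bracket_bilin HL.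
Let an := lr_anchor_bilin HL.
Let tp := tpure_bilinear A L.
Let mu := bilinear_mul A.

Let smulP c : bilinear_map (fun (a : A) (X : L) => tpure (c * a) X).
Proof. exact: bilinear_pre tp (bilinear_r c mu) (@linear_id _ _). Qed.

Let anchorP b : bilinear_map (fun (a : A) (X : L) => a * lr_anchor X b).
Proof. exact: bilinear_pre mu (@linear_id _ _) (bilinear_l b an). Qed.

Let bracket1 (a : A) (X : L) : bilinear_map (fun (b : A) (Y : L) =>
  tpure (a * b) (lr_bracket X Y) + tpure (a * lr_anchor X b) Y
  - tpure (b * lr_anchor Y a) X).
Proof.
apply: bilinear_add; first apply: bilinear_add.
- exact: bilinear_pre tp (bilinear_r a mu) (bilinear_r X br).
- apply: bilinear_pre tp _ (@linear_id _ _).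
  exact: linear_comp (bilinear_r a mu) (bilinear_r X an).
- apply: bilinear_opp.
  exact: (bilinear_post (f := fun c : A => tpure c X) (anchorP a) (bilinear_l X tp)).
Qed.

Let bracket2 (b : A) (Y : L) : bilinear_map (fun (a : A) (X : L) =>
  tpure (a * b) (lr_bracket X Y) + tpure (a * lr_anchor X b) Y
  - tpure (b * lr_anchor Y a) X).
Proof.
apply: bilinear_add; first apply: bilinear_add.
- exact: bilinear_pre tp (bilinear_l b mu) (bilinear_l Y br).
- exact: (bilinear_post (f := fun c : A => tpure c Y) (anchorP b) (bilinear_l Y tp)).
- apply: bilinear_opp; apply: bilinear_pre tp _ (@linear_id _ _).
  exact: linear_comp (bilinear_r b mu) (bilinear_r Y an).
Qed.

Lemma lr_tens_bilinear : lr_bilinear (lr_tens L).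
Proof.
split=> /=.
- apply: bilinearI => [u|c]; last exact: tlift_lin.
  apply: tlift_param => a X; apply: linear_comp (bilinear_l X tp) _.
  exact: (bilinear_l a mu).
- exact: tlift2_bilinear.
- apply: bilinearI => [b|u]; first exact: tlift_lin.
  apply: tlift_param => a X; apply: linear_comp (bilinear_r a mu) _.
  exact: (bilinear_r X an).
Qed.

Lemma lr_tens_bracketE a X b Y :
  lr_bracket (tpure a X : lr_tens L) (tpure b Y) =
  tpure (a * b) (lr_bracket X Y) + tpure (a * lr_anchor X b) Y
  - tpure (b * lr_anchor Y a) X.
Proof. exact: (tlift2_pure bracket1 bracket2). Qed.

Lemma lr_tens_anchorE a X b :
  lr_anchor (tpure a X : lr_tens L) b = a * lr_anchor X b.
Proof. by rewrite /= tlift_pure. Qed.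

End LRTensBilinear.

Lemma lr_pow_bilinear (K : fieldType) (A : comAlgType K) (L : lr_alg A) p :
  lr_bilinear L -> lr_bilinear (lr_pow L p).
Proof. by move=> h; elim: p => //= p IH; exact: lr_tens_bilinear. Qed.

(** * The canonical cocycle *)

Section HH1Theory.
Variables (K : fieldType) (S : algType K).
Local Notation A := (center S).
Local Notation L := (HH1_lr S).

Lemma der_linE k (D E : der S) x : (k *: D + E) x = k *: D x + E x.
Proof. by []. Qed.

Lemma der_addE (D E : der S) x : (D + E) x = D x + E x.
Proof. by []. Qed.

Lemma der_oppE (D : der S) x : (- D) x = - D x.
Proof. by []. Qed.

Lemma der_bracketE (D E : der S) x : der_bracket D E x = D (E x) - E (D x).
Proof. by []. Qed.

Lemma der_smulE a (D : der S) x : der_smul a D x = val a * D x.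
Proof. by []. Qed.

Lemma der_ext (D E : der S) : (forall x, D x = E x) -> D = E.
Proof. by move=> h; apply/val_inj/funext. Qed.

Let derE := (der_linE, der_addE, der_oppE, der_bracketE, der_smulE).

Lemma HH1_ex (X : HH1 S) : exists D, X = HH1_class D.
Proof. by exists (HH1_repr X); rewrite HH1_reprK. Qed.

Lemma HH1_lr_bilinear : lr_bilinear L.
Proof.
split; split.
- move=> k a b X; have [D ->] := HH1_ex X; rewrite !HH1_smulE -linearP.
  congr HH1_class; apply/der_ext => x.
  by rewrite !derE mulrDl scalerAl.
- move=> k a X Y; have [D ->] := HH1_ex X; have [E ->] := HH1_ex Y.
  rewrite -linearP !HH1_smulE -linearP; congr HH1_class; apply/der_ext => x.
  by rewrite !derE mulrDr scalerAr.
- move=> k X Y Z; have [D ->] := HH1_ex X; have [E ->] := HH1_ex Y.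
  have [F ->] := HH1_ex Z; rewrite -linearP !HH1_bracketE -linearP; congr HH1_class.
  by apply/der_ext => x; rewrite !derE derP scalerBr; zmod.
- move=> k Z X Y; have [D ->] := HH1_ex X; have [E ->] := HH1_ex Y.
  have [F ->] := HH1_ex Z; rewrite -linearP !HH1_bracketE -linearP; congr HH1_class.
  by apply/der_ext => x; rewrite !derE derP scalerBr; zmod.
- move=> k X Y a; have [D ->] := HH1_ex X; have [E ->] := HH1_ex Y.
  by rewrite -linearP !HH1_anchorE; apply/val_inj.
- move=> k X a b; have [D ->] := HH1_ex X; rewrite !HH1_anchorE.
  by apply/val_inj; rewrite /= derP.
Qed.

Lemma HH1_bracketxx (X : L) : lr_bracket X X = 0.
Proof.
have [D ->] := HH1_ex X; rewrite HH1_bracketE -(linear0 (@HH1_class K S)).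
by congr HH1_class; apply/der_ext => x; rewrite der_bracketE subrr.
Qed.

Lemma HH1_bracketC (X Y : L) : lr_bracket X Y = - lr_bracket Y X.
Proof.
have [D ->] := HH1_ex X; have [E ->] := HH1_ex Y.
by rewrite !HH1_bracketE -linearN -der_bracketC.
Qed.

Lemma HH1_jacobi (X Y Z : L) :
  lr_bracket (lr_bracket X Y) Z
  = lr_bracket (lr_bracket X Z) Y + lr_bracket X (lr_bracket Y Z).
Proof.
have [D ->] := HH1_ex X; have [E ->] := HH1_ex Y; have [F ->] := HH1_ex Z.
rewrite !HH1_bracketE -linearD; congr HH1_class; apply/der_ext => x.
rewrite !derE !derD !derN; zmod.
Qed.

Lemma HH1_anchor_smul a (X : L) b :
  lr_anchor (lr_smul a X) b = a * lr_anchor X b.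
Proof.
have [D ->] := HH1_ex X; rewrite HH1_smulE !HH1_anchorE.
exact/val_inj.
Qed.

Lemma HH1_smulA a b (X : L) : lr_smul a (lr_smul b X) = lr_smul (a * b) X.
Proof.
have [D ->] := HH1_ex X; rewrite (HH1_smulE b) (HH1_smulE a) (HH1_smulE (a * b)).
by congr HH1_class; apply/der_ext => x; exact: mulrA.
Qed.

(** The right-hand side is the image of the bracket of the tensors a (x) X and b (x) Y in [lr_tens]:
    multiplication from A (x) L to L preserves brackets. *)
Lemma HH1_bracket_smul a (X : L) b (Y : L) :
  lr_bracket (lr_smul a X) (lr_smul b Y) =
  lr_smul (a * b) (lr_bracket X Y) + lr_smul (a * lr_anchor X b) Y
  - lr_smul (b * lr_anchor Y a) X.
Proof.
have [D ->] := HH1_ex X; have [E ->] := HH1_ex Y.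
rewrite (HH1_smulE a) (HH1_smulE b) !HH1_bracketE !HH1_anchorE !HH1_smulE.
rewrite -linearD -linearB.
congr HH1_class; apply/der_ext => x.
have vM c d : val (c * d : A) = val c * val d by [].
have vD (F : der S) c : val (der_center F c) = F (val c) by [].
have ba z : val b * (val a * z) = val a * (val b * z) by rewrite !mulrA (centerP b).
rewrite !derE !vM !vD !derM !mulrDr !mulrN -!mulrA ba; zmod.
Qed.

End HH1Theory.

Section CanonicalCochain.
Variables (K : fieldType) (S : algType K) (sec : sections S).
Local Notation A := (center S).
Local Notation L := (HH1_lr S).
Local Notation p := (der_lift sec).
Local Notation q := (ad_lift sec).
Let tp := tpure_bilinear A L.
Let sm := lr_smul_bilin (HH1_lr_bilinear S).
Let br := lr_bracket_bilin (HH1_lr_bilinear S).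

Lemma der_lift_anchor (X : L) a : val (lr_anchor X a) = p X (val a).
Proof. by rewrite -{1}(der_liftK sec X) HH1_anchorE. Qed.

Lemma inner_curvature (X Y : L) :
  inner (der_bracket (p X) (p Y) - p (lr_bracket X Y)).
Proof. by apply/HH1_classP; rewrite -HH1_bracketE !der_liftK. Qed.

Lemma inner_smul_defect a (X : L) : inner (der_smul a (p X) - p (lr_smul a X)).
Proof. by apply/HH1_classP; rewrite -HH1_smulE !der_liftK. Qed.

Lemma der_bracket_linear_l (E : der S) : linear (fun D : der S => der_bracket D E).
Proof.
move=> k D F; rewrite der_bracketDl; congr (_ + _); apply/der_ext => x.
by rewrite -[LHS]/(k *: D (E x) - E (k *: D x)) derZ -scalerBr.
Qed.

Lemma der_bracket_bilinear : bilinear_map (@der_bracket K S).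
Proof.
split=> k D E F; first exact: der_bracket_linear_l.
by rewrite der_bracketC der_bracket_linear_l opprD -scalerN -!der_bracketC.
Qed.

Lemma der_smul_bilinear : bilinear_map (@der_smul K S).
Proof.
split=> [k a b D|k a D E]; apply/der_ext => x; rewrite !(der_linE, der_smulE).
  by rewrite mulrDl scalerAl.
by rewrite mulrDr scalerAr.
Qed.

(** [ad_lift] is linear on inner derivations only, so the arguments have to be known to be inner
    before linearity applies. *)
Lemma bilinear_ad_lift (V W : lmodType K) (phi : V -> W -> der S) :
  bilinear_map phi -> (forall v w, inner (phi v w)) ->
  bilinear_map (fun v w => q (phi v w)).
Proof. by move=> [h1 h2] h; split=> k *; rewrite (h1, h2) ad_lift_linear. Qed.

Let p_lin : linear (p : L -> der S). Proof. exact: linearP. Qed.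

Lemma sec_t_bilinear : bilinear_map (sec_t sec).
Proof.
apply: bilinear_ad_lift inner_curvature; apply: bilinear_add.
  exact: bilinear_pre der_bracket_bilinear p_lin p_lin.
exact: bilinear_opp (bilinear_post br p_lin).
Qed.

(** The function underlying [sec_s], for statements about pure tensors without [tlift]. *)
Definition sec_s0 (a : A) (X : L) : S := q (der_smul a (p X) - p (lr_smul a X)).

Lemma sec_s0_bilinear : bilinear_map sec_s0.
Proof.
apply: bilinear_ad_lift inner_smul_defect; apply: bilinear_add.
  exact: bilinear_pre der_smul_bilinear (@linear_id _ _) p_lin.
exact: bilinear_opp (bilinear_post sm p_lin).
Qed.

Lemma sec_s_linear : linear (sec_s sec : lr_tens L -> S).
Proof. exact: tlift_lin sec_s0_bilinear. Qed.

Lemma sec_sE a X : sec_s sec (tpure a X) = sec_s0 a X.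
Proof. exact: tlift_pure sec_s0_bilinear. Qed.

Lemma sec_txx X : sec_t sec X X = 0.
Proof.
rewrite /sec_t HH1_bracketxx linear0 subr0 (_ : der_bracket _ _ = 0).
  have := ad_lift_linear sec (-1) (@inner0 K S) (@inner0 K S).
  by rewrite scaler0 addr0 scaleN1r addNr.
by apply/val_inj/funext => x /=; rewrite subrr.
Qed.

Lemma ad_sec_t (X Y : L) x :
  sec_t sec X Y * x - x * sec_t sec X Y
  = p X (p Y x) - p Y (p X x) - p (lr_bracket X Y) x.
Proof.
by rewrite -[LHS]/(ad (sec_t sec X Y) x) ad_liftK //; exact: inner_curvature.
Qed.

Lemma ad_sec_s0 a (X : L) x :
  sec_s0 a X * x - x * sec_s0 a X = val a * p X x - p (lr_smul a X) x.
Proof.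
by rewrite -[LHS]/(ad (sec_s0 a X) x) ad_liftK //; exact: inner_smul_defect.
Qed.

Definition canon_g0 (a : A) (X : L) (b : A) (Y : L) : S :=
  let u := tpure a X : lr_pow L 1 in
  let v := tpure b Y : lr_pow L 1 in
  val (a * b) * sec_t sec X Y - sec_t sec (lr_smul a X) (lr_smul b Y)
  - (p (lr_smul a X) (sec_s sec v) - p (lr_smul b Y) (sec_s sec u)
     - sec_s sec (lr_bracket u v)
     + (sec_s sec u * sec_s sec v - sec_s sec v * sec_s sec u)).

Let der_lin (D : der S) : linear (D : S -> S).
Proof. by move=> k x y; exact: derP. Qed.
Let eval_lin (x : S) : linear (fun X : L => p X x).
Proof. by move=> k X Y; rewrite p_lin. Qed.
Let val_lin : linear (val : A -> S). Proof. by []. Qed.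
Let muA := bilinear_mul A.
Let muS := bilinear_mul S.
Let s_bilin := bilinear_post tp sec_s_linear.
Let brT := lr_bracket_bilin (lr_tens_bilinear (HH1_lr_bilinear S)).

Lemma canon_g0_bilinear1 a X : bilinear_map (canon_g0 a X).
Proof.
apply: bilinear_add.
  apply: bilinear_add.
    apply: bilinear_pre muS _ (bilinear_r X sec_t_bilinear).
    exact: linear_comp val_lin (bilinear_r a muA).
  apply: bilinear_opp; exact: bilinear_post sm (bilinear_r _ sec_t_bilinear).
apply: bilinear_opp; apply: bilinear_add.
  apply: bilinear_add; first apply: bilinear_add.
  - exact: bilinear_post s_bilin (@der_lin _).
  - exact: bilinear_opp (bilinear_post sm (@eval_lin _)).
  - apply: bilinear_opp; apply: bilinear_post tp (linear_comp sec_s_linear _).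
    exact: bilinear_r brT.
apply: bilinear_add; first exact: bilinear_post s_bilin (bilinear_r _ muS).
exact: bilinear_opp (bilinear_post s_bilin (bilinear_l _ muS)).
Qed.

Lemma canon_g0_bilinear2 b Y : bilinear_map (fun a X => canon_g0 a X b Y).
Proof.
apply: bilinear_add.
  apply: bilinear_add.
    apply: bilinear_pre muS _ (bilinear_l Y sec_t_bilinear).
    exact: linear_comp val_lin (bilinear_l b muA).
  apply: bilinear_opp; exact: bilinear_post sm (bilinear_l _ sec_t_bilinear).
apply: bilinear_opp; apply: bilinear_add.
  apply: bilinear_add; first apply: bilinear_add.
  - exact: bilinear_post sm (@eval_lin _).
  - exact: bilinear_opp (bilinear_post s_bilin (@der_lin _)).
  - apply: bilinear_opp; apply: bilinear_post tp (linear_comp sec_s_linear _).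
    exact: bilinear_l brT.
apply: bilinear_add; first exact: bilinear_post s_bilin (bilinear_l _ muS).
exact: bilinear_opp (bilinear_post s_bilin (bilinear_r _ muS)).
Qed.

Lemma canon_g_bilinear : bilinear_map (canon_g sec).
Proof. exact: (tlift2_bilinear canon_g0_bilinear1 canon_g0_bilinear2). Qed.

Lemma canon_gE a X b Y : canon_g sec (tpure a X) (tpure b Y) =
  val (a * b) * sec_t sec X Y - sec_t sec (lr_smul a X) (lr_smul b Y)
  - (p (lr_smul a X) (sec_s0 b Y) - p (lr_smul b Y) (sec_s0 a X)
     - (sec_s0 (a * b) (lr_bracket X Y) + sec_s0 (a * lr_anchor X b) Y
        - sec_s0 (b * lr_anchor Y a) X)
     + (sec_s0 a X * sec_s0 b Y - sec_s0 b Y * sec_s0 a X)).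
Proof.
rewrite [LHS](tlift2_pure canon_g0_bilinear1 canon_g0_bilinear2) /canon_g0.
rewrite (lr_tens_bracketE (HH1_lr_bilinear S)).
by rewrite !(linear_funD _ _ sec_s_linear) (linear_funN _ sec_s_linear) !sec_sE.
Qed.

Let h0 (a b : A) (X : L) : S :=
  val a * sec_s sec (tpure b X) - sec_s sec (tpure (a * b) X)
  + sec_s sec (tpure a (lr_smul b X)).

Let h0_bilinear a : bilinear_map (h0 a).
Proof.
apply: bilinear_add; first apply: bilinear_add.
- exact: bilinear_post s_bilin (bilinear_r _ muS).
- apply: bilinear_opp; exact: bilinear_pre s_bilin (bilinear_r _ muA) (@linear_id _ _).
- exact: bilinear_post sm (bilinear_r _ s_bilin).
Qed.

Let h1_bilinear : bilinear_map (fun a (v : lr_pow L 1) => tlift (h0 a) v).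
Proof.
apply: bilinearI => [v|a]; last exact: tlift_lin.
apply: tlift_param => b X; apply: linear_add; first apply: linear_add.
- exact: linear_comp (bilinear_l _ muS) val_lin.
- apply: linear_opp; exact: linear_comp (bilinear_l _ s_bilin) (bilinear_l _ muA).
- exact: bilinear_l s_bilin.
Qed.

Lemma canon_h_linear : linear (canon_h sec).
Proof. exact: tlift_lin h1_bilinear. Qed.

Lemma canon_hE a b X : canon_h sec (tpure a (tpure b X)) =
  val a * sec_s0 b X - sec_s0 (a * b) X + sec_s0 a (lr_smul b X).
Proof.
rewrite [LHS](tlift_pure _ _ h1_bilinear) (tlift_pure _ _ (h0_bilinear a)).
by rewrite /h0 !sec_sE.
Qed.

End CanonicalCochain.

(** * Comparison of the cocycles along a connection *)

Section ConnectionIdentities.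
Variables (K : fieldType) (R : algType K) (V : lmodType R).
Local Notation A := (center R).
Local Notation L := (HH1_lr R).
Variable nabla : L -> V -> V.
Hypothesis nablaD : forall X y z, nabla X (y + z) = nabla X y + nabla X z.
Hypothesis nabla_add : forall X Y y, nabla (X + Y) y = nabla X y + nabla Y y.
Hypothesis nablaM : forall X (a : A) y,
  nabla X (val a *: y) = val (lr_anchor X a) *: y + val a *: nabla X y.
Variables (beta : L -> L -> A) (gamma : A -> L -> A).

(** [curv] and [defect] stand for the operators by which the pairs (t_R, t_S) and (s_R, s_S) act on
    P. The left sides below copy the formulas for f, g and h. *)
Let curv X Y y :=
  nabla X (nabla Y y) - nabla Y (nabla X y) - nabla (lr_bracket X Y) y
  - val (beta X Y) *: y.
Let defect (a : A) X y :=
  val a *: nabla X y - nabla (lr_smul a X) y - val (gamma a X) *: y.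

Let nabla0 X : nabla X 0 = 0.
Proof. by apply: (addrI (nabla X 0)); rewrite -nablaD !addr0. Qed.
Let nablaN X y : nabla X (- y) = - nabla X y.
Proof. by apply: (addrI (nabla X y)); rewrite -nablaD !subrr nabla0. Qed.
Let nabla0l y : nabla 0 y = 0.
Proof. by apply: (addrI (nabla 0 y)); rewrite -nabla_add !addr0. Qed.
Let nabla_opp X y : nabla (- X) y = - nabla X y.
Proof. by apply: (addrI (nabla X y)); rewrite -nabla_add !subrr nabla0l. Qed.
Let valD (a b : A) (y : V) : val (a + b) *: y = val a *: y + val b *: y.
Proof. exact: scalerDl. Qed.
Let valN (a : A) (y : V) : val (- a) *: y = - (val a *: y).
Proof. exact: scaleNr. Qed.
Let valM (a b : A) (y : V) : val (a * b) *: y = val a *: (val b *: y).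
Proof. by rewrite scalerA. Qed.
Let valC (a b : A) (y : V) : val a *: (val b *: y) = val b *: (val a *: y).
Proof. by rewrite !scalerA (centerP a). Qed.

(** The genuine curvature cancels by the Jacobi identities for operators and for L. The terms in
    beta remain, since the commutator of nabla_X with a central b is multiplication by X(b). *)
Lemma bianchi X Y Z y :
  - (nabla X (curv Y Z y) - curv Y Z (nabla X y)
     - (nabla Y (curv X Z y) - curv X Z (nabla Y y))
     + (nabla Z (curv X Y y) - curv X Y (nabla Z y))
     - curv (lr_bracket X Y) Z y + curv (lr_bracket X Z) Y y
     - curv (lr_bracket Y Z) X y)
  = val (lr_anchor X (beta Y Z) - lr_anchor Y (beta X Z) + lr_anchor Z (beta X Y)
         - beta (lr_bracket X Y) Z + beta (lr_bracket X Z) Y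
         - beta (lr_bracket Y Z) X) *: y.
Proof.
rewrite /curv HH1_jacobi (HH1_bracketC X (lr_bracket Y Z)) nabla_add nabla_opp.
rewrite !nablaD !nablaN !nablaM !valD !valN; zmod.
Qed.

(** Compute the commutator of a nabla_X and b nabla_Y in two ways: by the Leibniz rule, and after
    substituting a nabla_X = nabla_(aX) + (defect of a and X), where the defect is taken without its
    gamma term. The comparison is the identity for beta = gamma = 0; the right side collects the
    central corrections. *)
Lemma curvature_defect (a : A) X (b : A) Y y :
  val (a * b) *: curv X Y y - curv (lr_smul a X) (lr_smul b Y) y
  - (nabla (lr_smul a X) (defect b Y y) - defect b Y (nabla (lr_smul a X) y)
     - (nabla (lr_smul b Y) (defect a X y) - defect a X (nabla (lr_smul b Y) y))
     - (defect (a * b) (lr_bracket X Y) y + defect (a * lr_anchor X b) Y y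
        - defect (b * lr_anchor Y a) X y)
     + (defect a X (defect b Y y) - defect b Y (defect a X y)))
  = val (- (a * b * beta X Y) + beta (lr_smul a X) (lr_smul b Y)
         + (lr_anchor (lr_smul a X) (gamma b Y) - lr_anchor (lr_smul b Y) (gamma a X)
            - (gamma (a * b) (lr_bracket X Y) + gamma (a * lr_anchor X b) Y
               - gamma (b * lr_anchor Y a) X))) *: y.
Proof.
rewrite /curv /defect HH1_bracket_smul !nabla_add nabla_opp.
rewrite !HH1_anchor_smul !nablaD !nablaN !nablaM !HH1_anchor_smul.
rewrite !valD !valN !valD !valN !valM !scalerDr !scalerN !scalerDr.
(* Iterated scalings are atoms for [zmod], so commuting central factors are first brought into one
   order. *)
rewrite !(valC b a) !(valC (gamma a X) (gamma b Y)).
rewrite !(valC (gamma a X) b) !(valC (gamma b Y) a).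
zmod.
Qed.

(** Apart from gamma the defect is itself a horizontal coboundary, that of nabla, so its terms
    telescope. *)
Lemma defect_cocycle (a b : A) X y :
  val a *: defect b X y - defect (a * b) X y + defect a (lr_smul b X) y
  = val (- (a * gamma b X - gamma (a * b) X + gamma a (lr_smul b X))) *: y.
Proof.
rewrite /defect HH1_smulA !(valD, valN, valM, scalerDr, scalerN); zmod.
Qed.

End ConnectionIdentities.

Section Comparison.
Variables (K : fieldType) (S R : algType K) (P : bimod S R).
Variables (secS : sections S) (secR : sections R).
Variable chi : lr_iso (HH1_lr R) (HH1_lr S).
Local Notation A := (center R).
Local Notation L := (HH1_lr R).
Local Notation ch := (iso_lie chi).
Local Notation ca := (iso_ring chi).
Variable nabla : L -> P -> P.
Hypothesis act_center : forall (a : A) (y : P), val a *: y = ract y (val (ca a)).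
Hypothesis nabla_leibniz : forall X,
  leibniz (der_lift secS (ch X)) (der_lift secR X) (nabla X).
Hypothesis nabla_add : forall X Y y, nabla (X + Y) y = nabla X y + nabla Y y.
Variables (beta : L -> L -> A) (gamma : A -> L -> A).
Hypothesis betaE : forall X Y y,
  sec_t secR X Y *: y - ract y (sec_t secS (ch X) (ch Y)) =
  nabla X (nabla Y y) - nabla Y (nabla X y) - nabla (lr_bracket X Y) y
  - val (beta X Y) *: y.
Hypothesis gammaE : forall (a : A) X y,
  sec_s0 secR a X *: y - ract y (sec_s0 secS (ca a) (ch X)) =
  val a *: nabla X y - nabla (lr_smul a X) y - val (gamma a X) *: y.

(* The action on P of the crossed module R + S, whose elements (r, s) are
   combined componentwise below. *)
Let act (r : R) (s : S) (y : P) := r *: y - ract y s.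

Let nablaD X y z : nabla X (y + z) = nabla X y + nabla X z.
Proof. by case: (nabla_leibniz X). Qed.
Let nablaN X y : nabla X (- y) = - nabla X y.
Proof. exact: leibnizN (nabla_leibniz X). Qed.

Let nablaM X (a : A) y :
  nabla X (val a *: y) = val (lr_anchor X a) *: y + val a *: nabla X y.
Proof. by case: (nabla_leibniz X) => _ -> _; rewrite (der_lift_anchor secR). Qed.

Let actD r r' s s' y : act (r + r') (s + s') y = act r s y + act r' s' y.
Proof. by rewrite /act scalerDl ractDr; zmod. Qed.
Let actN r s y : act (- r) (- s) y = - act r s y.
Proof. by rewrite /act scaleNr ractNr; zmod. Qed.
Let act_smul (a : A) r s y : act (val a * r) (val (ca a) * s) y = val a *: act r s y.
Proof. by rewrite /act ractM -act_center ractZl scalerBr scalerA. Qed.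
Let act_comm r s r' s' y :
  act (r * r' - r' * r) (s * s' - s' * s) y = act r s (act r' s' y) - act r' s' (act r s y).
Proof.
rewrite /act scalerBl !scalerBr !scalerA !ractDl !ractNl !ractZl.
by rewrite ractDr ractNr !ractM; zmod.
Qed.
Let act_nabla X r s y :
  act (der_lift secR X r) (der_lift secS (ch X) s) y
  = nabla X (act r s y) - act r s (nabla X y).
Proof.
by case: (nabla_leibniz X) => _ h2 h3; rewrite /act nablaD nablaN h2 h3; zmod.
Qed.
Let act_t X Y y : act (sec_t secR X Y) (sec_t secS (ch X) (ch Y)) y =
  nabla X (nabla Y y) - nabla Y (nabla X y) - nabla (lr_bracket X Y) y
  - val (beta X Y) *: y.
Proof. exact: betaE. Qed.
Let act_s a X y : act (sec_s0 secR a X) (sec_s0 secS (ca a) (ch X)) y =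
  val a *: nabla X y - nabla (lr_smul a X) y - val (gamma a X) *: y.
Proof. exact: gammaE. Qed.

(** The rules for [act] translate the formula for f, applied to the pair of cocycles, into the same
    formula in operators on P. The comparisons of g and h work alike. *)
Lemma canon_f_compare X Y Z (y : P) :
  canon_f secR X Y Z *: y - ract y (canon_f secS (ch X) (ch Y) (ch Z)) =
  val (lr_anchor X (beta Y Z) - lr_anchor Y (beta X Z) + lr_anchor Z (beta X Y)
       - beta (lr_bracket X Y) Z + beta (lr_bracket X Z) Y
       - beta (lr_bracket Y Z) X) *: y.
Proof.
rewrite -(bianchi nablaD nabla_add nablaM) -[LHS]/(act _ _ y) /canon_f.
by rewrite -!(iso_lie_bracket chi) !(actN, actD) !act_nabla !act_t.
Qed.

Lemma canon_g_compare (a : A) X (b : A) Y (y : P) :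
  canon_g secR (tpure a X) (tpure b Y) *: y
  - ract y (canon_g secS (tpure (ca a) (ch X)) (tpure (ca b) (ch Y))) =
  val (- (a * b * beta X Y) + beta (lr_smul a X) (lr_smul b Y)
       + (lr_anchor (lr_smul a X) (gamma b Y) - lr_anchor (lr_smul b Y) (gamma a X)
          - (gamma (a * b) (lr_bracket X Y) + gamma (a * lr_anchor X b) Y
             - gamma (b * lr_anchor Y a) X))) *: y.
Proof.
rewrite -(curvature_defect nablaD nabla_add nablaM) -[LHS]/(act _ _ y) !canon_gE.
rewrite -!(iso_lie_bracket chi) -!(iso_lie_smul chi) -!(iso_lie_anchor chi) -!rmorphM.
have := act_comm (sec_s0 secR a X) (sec_s0 secS (ca a) (ch X))
  (sec_s0 secR b Y) (sec_s0 secS (ca b) (ch Y)) y.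
(* The commutators are hidden from [actN] and [actD], which would split their differences;
   [act_comm] needs them whole. *)
set cR := _ - _ * sec_s0 secR a X; set cS := _ - _ * sec_s0 secS (ca a) (ch X).
move: cR cS => cR cS commE.
by rewrite !(actN, actD) commE act_smul !act_nabla !act_t !act_s.
Qed.

Lemma canon_h_compare (a b : A) X (y : P) :
  canon_h secR (tpure a (tpure b X)) *: y
  - ract y (canon_h secS (tpure (ca a) (tpure (ca b) (ch X)))) =
  val (- (a * gamma b X - gamma (a * b) X + gamma a (lr_smul b X))) *: y.
Proof.
rewrite -(defect_cocycle nabla) -[LHS]/(act _ _ y) !canon_hE.
by rewrite -!(iso_lie_smul chi) -!rmorphM !(actN, actD) act_smul !act_s.
Qed.

End Comparison.

Definition lr_iso_id (K : fieldType) (A : comAlgType K) (L : lr_alg A) : lr_iso L L :=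
  @LRIso K A A L L idfun idfun (fun=> erefl) (fun=> erefl) idfun idfun
    (fun=> erefl) (fun=> erefl) (fun _ _ => erefl) (fun _ _ => erefl)
    (fun _ _ => erefl).

Section Central.
Variables (K : fieldType) (R : algType K) (sec : sections R).
Local Notation A := (center R).
Local Notation L := (HH1_lr R).
Let P := regular_bimod R.
Let nabla (X : L) : P -> P := der_lift sec X.

Let act_center (a : A) (y : P) : val a *: y = ract y (val (iso_ring (lr_iso_id L) a)).
Proof. exact: centerP. Qed.
Let nabla_leibniz (X : L) :
  leibniz (der_lift sec (iso_lie (lr_iso_id L) X)) (der_lift sec X) (nabla X).
Proof. by split=> *; [exact: derD | exact: derM | rewrite /= /nabla derM]. Qed.
Let nabla_add X Y y : nabla (X + Y) y = nabla X y + nabla Y y.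
Proof. by rewrite /nabla linearD. Qed.
Let tE X Y y : sec_t sec X Y *: y
    - ract y (sec_t sec (iso_lie (lr_iso_id L) X) (iso_lie (lr_iso_id L) Y)) =
  nabla X (nabla Y y) - nabla Y (nabla X y) - nabla (lr_bracket X Y) y
  - val (0 : A) *: y.
Proof. by rewrite scale0r subr0; exact: ad_sec_t. Qed.
Let sE (a : A) X y : sec_s0 sec a X *: y
    - ract y (sec_s0 sec (iso_ring (lr_iso_id L) a) (iso_lie (lr_iso_id L) X)) =
  val a *: nabla X y - nabla (lr_smul a X) y - val (0 : A) *: y.
Proof. by rewrite scale0r subr0; exact: ad_sec_s0. Qed.

Let centralI (c : R) : (forall y : R, c * y - y * c = 0) -> c \in center_pred (S := R).
Proof. by move=> h; apply/center_predP => y; apply/eqP; rewrite -subr_eq0 h. Qed.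

Lemma canon_val_center n (us : seq (lr_pow L n)) :
  canon_val sec us \in center_pred (S := R).
Proof.
have an0 (X : L) : lr_anchor X 0 = 0 by apply/val_inj; rewrite /= der0.
case: n us => [|[|[|n]]] [|u us] /=; try exact: rpred0.
- case: us => [|v us]; first exact: rpred0.
  case: us => [|w [|? ?]]; try exact: rpred0.
  apply: centralI => y.
  have := canon_f_compare (beta := fun _ _ => 0) nabla_leibniz nabla_add tE u v w y.
  by rewrite !an0 !(subr0, addr0) scale0r.
- case: us => [|v [|? ?]]; try exact: rpred0.
  have g_bilin := canon_g_bilinear sec.
  elim/tens_ind: u => [u u' hu hu'|a X].
    by rewrite (linear_funD _ _ (bilinear_l v g_bilin)) rpredD.
  elim/tens_ind: v => [v v' hv hv'|b Y].
    by rewrite (linear_funD _ _ (bilinear_r _ g_bilin)) rpredD.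
  apply: centralI => y.
  have := canon_g_compare (beta := fun _ _ => 0) (gamma := fun _ _ => 0)
    act_center nabla_leibniz nabla_add tE sE a X b Y y.
  by rewrite !an0 mulr0 !(oppr0, subr0, addr0) scale0r.
- case: us => [|? ?]; try exact: rpred0.
  have h_lin := canon_h_linear sec.
  elim/tens_ind: u => [u u' hu hu'|a v]; first by rewrite (linear_funD _ _ h_lin) rpredD.
  elim/tens_ind: v => [v v' hv hv'|b X].
    by rewrite (linear_funD _ _ (bilinear_r a (tpure_bilinear _ _))) (linear_funD _ _ h_lin) rpredD.
  apply: centralI => y.
  have := canon_h_compare (gamma := fun _ _ => 0) act_center sE a b X y.
  by rewrite mulr0 !(oppr0, subr0, addr0) scale0r.
Qed.

Lemma canon_cocycleE n (us : seq (lr_pow L n)) :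
  val (canon_cocycle sec us) = canon_val sec us.
Proof. by rewrite /canon_cocycle insubdK // canon_val_center. Qed.

End Central.

(** * Transport of the complex *)

Section ScalarExt.
Variables (K : fieldType) (A : comAlgType K) (W : lmodType K).
Implicit Types (f g : seq W -> A).

Lemma multilinear_head f us : multilinear f -> linear (fun w => f (w :: us)).
Proof. by move=> h k u v; exact: (h [::]). Qed.

Lemma multilinear_tail f w : multilinear f -> multilinear (fun ws => f (w :: ws)).
Proof. by move=> h us vs k u v; exact: (h (w :: us)). Qed.

Lemma scalar_ext_lin k f g us :
  scalar_ext (fun ws => k *: f ws + g ws) us = k *: scalar_ext f us + scalar_ext g us.
Proof.
elim: us f g => [//|u us IH] f g /=; rewrite /tlift /tens_eval scaler_sumr -big_split.
by apply: eq_bigr => x _; rewrite IH mulrDr scalerAr.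
Qed.

Lemma scalar_ext_bilinear f us : multilinear f ->
  bilinear_map (fun (a : A) w => a * scalar_ext (fun ws => f (w :: ws)) us).
Proof.
move=> h; apply: bilinear_pre (bilinear_mul A) (@linear_id _ _) _ => k u v.
rewrite -scalar_ext_lin; congr scalar_ext; apply/funext => ws.
exact: multilinear_head.
Qed.

Lemma scalar_ext0 f us : (forall ws, size ws = size us -> f ws = 0) -> scalar_ext f us = 0.
Proof.
elim: us f => [|u us IH] f h /=; first exact: h.
by rewrite /tlift /tens_eval big1 // => x _; rewrite IH ?mulr0 // => ws e; rewrite h //= e.
Qed.

End ScalarExt.

Section Faces.
Variables (K : fieldType) (A : comAlgType K) (L : lr_alg A).
Hypothesis HL : lr_bilinear L.

Lemma merge_bilinear p (a : A) :
  bilinear_map (fun (b : A) (w : lr_pow L p) => tpure (a * b) w).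
Proof.
apply: bilinear_pre (tpure_bilinear _ _) _ (@linear_id _ _).
exact: bilinear_r (bilinear_mul A).
Qed.

Lemma merge2_bilinear p : bilinear_map (fun (a : A) (u : lr_pow L p.+1) =>
  tlift (fun (b : A) (w : lr_pow L p) => tpure (a * b) w) u).
Proof.
apply: bilinearI => [u|a]; last exact/tlift_lin/merge_bilinear.
apply: tlift_param => b w; apply: linear_comp (bilinear_l w (tpure_bilinear _ _)) _.
exact: bilinear_l (bilinear_mul A).
Qed.

Lemma face_linear p i : linear (@face K A L p i).
Proof.
elim: p i => [|p IH] [|i] /=; try exact: (tlift_lin (lr_smul_bilin HL)).
  exact: (tlift_lin (@merge2_bilinear p)).
apply: tlift_lin; exact: bilinear_pre (tpure_bilinear _ _) (@linear_id _ _) (IH i).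
Qed.

Lemma face_pure0 i a X : @face K A L 0 i (tpure a X) = lr_smul a X.
Proof. exact: (tlift_pure _ _ (lr_smul_bilin HL)). Qed.

Lemma face_pure1 p a b w :
  @face K A L p.+1 0 (tpure a (tpure b w)) = tpure (a * b) w.
Proof.
by rewrite [LHS](tlift_pure _ _ (@merge2_bilinear p)) (tlift_pure _ _ (@merge_bilinear p a)).
Qed.

Lemma face_pureS p i a u :
  @face K A L p.+1 i.+1 (tpure a u) = tpure a (face i u).
Proof.
apply: (tlift_pure _ _ (bilinear_pre (tpure_bilinear _ _) (@linear_id _ _) _)).
exact: face_linear.
Qed.

End Faces.

Section Coboundary.
Variables (K : fieldType) (A : comAlgType K) (L : lr_alg A).
Hypothesis HL : lr_bilinear L.

Lemma d_vert_lin p k (f g : seq (lr_pow L p) -> A) us :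
  d_vert (fun ws => k *: f ws + g ws) us = k *: d_vert f us + d_vert g us.
Proof.
rewrite /d_vert; case: us => [|u us]; first by rewrite !mulr0 scaler0 addr0.
have an := lr_anchor_bilin (lr_pow_bilinear p HL).
rewrite scalerAr -mulrDr; congr (_ * _); move: {u us}(u :: us) => us.
rewrite /chevalley_eilenberg scalerDr addrACA; congr (_ + _).
  rewrite scaler_sumr -big_split.
  by apply: eq_bigr => i _; rewrite (bilinear_r _ an) mulrDr scalerAr.
rewrite scaler_sumr -big_split; apply: eq_bigr => i _; rewrite scaler_sumr -big_split.
by apply: eq_bigr => j _; rewrite mulrDr scalerAr.
Qed.

Lemma d_hor_lin p k (f g : seq (lr_pow L p) -> A) us :
  d_hor (fun ws => k *: f ws + g ws) us = k *: d_hor f us + d_hor g us.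
Proof.
rewrite /d_hor scalar_ext_lin scalerDr addrACA scaler_sumr -big_split; congr (_ + _).
by apply: eq_bigr => i _; rewrite mulrDr scalerAr.
Qed.

Lemma d_tot_lin k (b c : bicochain L) p us :
  d_tot (fun p us => k *: b p us + c p us) us = k *: d_tot b (p := p) us + d_tot c us.
Proof.
case: p us => [|p] us; first exact: (@d_vert_lin 0%N).
rewrite /= d_hor_lin (@d_vert_lin p.+1).
move: (d_hor (b p) us) (d_hor (c p) us) (d_vert (b p.+1) us) (d_vert (c p.+1) us).
by move=> x y z w; rewrite mulrDr -scalerAr scalerDr addrACA.
Qed.

Lemma cochain_lin n k (b c : bicochain L) : cochain n b -> cochain n c ->
  cochain n (fun p us => k *: b p us + c p us).
Proof.
move=> [h1 h2] [h3 h4]; split=> [p|p us h]; last by rewrite h2 // h4 // scaler0 addr0.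
have [m1 a1] := h1 p; have [m2 a2] := h3 p; split=> [us vs l u v|us vs ws u].
  by rewrite m1 m2 !scalerDr !scalerA [k * l]mulrC addrACA.
by rewrite a1 a2 scaler0 addr0.
Qed.

End Coboundary.

Lemma lr_pow_ind (K : fieldType) (A : comAlgType K) (L : lr_alg A) p
    (Q : lr_pow L p.+1 -> Prop) :
  (forall u v : lr_pow L p.+1, Q u -> Q v -> Q (u + v)) ->
  (forall (a : A) (u : lr_pow L p), Q (tpure a u)) -> forall u, Q u.
Proof. exact: tens_ind. Qed.

Section Transport.
Variables (K : fieldType) (A A' : comAlgType K) (L : lr_alg A) (L' : lr_alg A').
Variable phi : lr_iso L L'.
Hypotheses (HL : lr_bilinear L) (HL' : lr_bilinear L').
Local Notation fA := (iso_ring phi).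
Local Notation gA := (iso_ring_inv phi).
Local Notation psi p := (@iso_pow_inv K A A' L L' phi p).

Lemma iso_ring_inv_linear : linear gA.
Proof. exact: can2_linear (iso_ringK phi) (iso_ring_invK phi). Qed.

Lemma iso_ring_inv_mul : {morph gA : a b / a * b}.
Proof.
move=> a b; apply: (can_inj (iso_ringK phi)).
by rewrite rmorphM /= !iso_ring_invK.
Qed.

Lemma iso_pow_inv_linear p : linear (psi p).
Proof.
elim: p => [|p IH] /=; first exact: can2_linear (iso_lieK phi) (iso_lie_invK phi).
by apply: tlift_lin; exact: bilinear_pre (tpure_bilinear _ _) iso_ring_inv_linear IH.
Qed.

Lemma iso_pow_inv_pure p a u : psi p.+1 (tpure a u) = tpure (gA a) (psi p u).
Proof.
apply: (tlift_pure _ _ (bilinear_pre (tpure_bilinear _ _) iso_ring_inv_linear _)).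
exact: iso_pow_inv_linear.
Qed.

Lemma iso_pow_inv_anchor p u a : fA (lr_anchor (psi p u) a) = lr_anchor u (fA a).
Proof.
elim: p u a => [|p IH] u a; first by rewrite /= iso_lie_anchor iso_lie_invK.
have [HT HT'] := (lr_pow_bilinear p HL, lr_pow_bilinear p HL').
have an := lr_anchor_bilin (lr_tens_bilinear HT).
have an' := lr_anchor_bilin (lr_tens_bilinear HT').
elim/lr_pow_ind: u => [u v hu hv|b u].
  rewrite (linear_funD _ _ (@iso_pow_inv_linear p.+1)).
  rewrite [lr_anchor (_ + _) a](linear_funD _ _ (bilinear_l a an)).
  rewrite [RHS](linear_funD _ _ (bilinear_l (fA a) an')) rmorphD.
  by congr (_ + _); [exact: hu | exact: hv].
rewrite iso_pow_inv_pure (lr_tens_anchorE HT) (lr_tens_anchorE HT').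
by rewrite rmorphM /= IH iso_ring_invK.
Qed.

Lemma iso_pow_inv_bracket p u v :
  psi p (lr_bracket u v) = lr_bracket (psi p u) (psi p v).
Proof.
elim: p u v => [|p IH] u v.
  apply: (can_inj (iso_lieK phi)); rewrite /= iso_lie_bracket.
  by rewrite !iso_lie_invK.
have [HT HT'] := (lr_pow_bilinear p HL, lr_pow_bilinear p HL').
have lin := @iso_pow_inv_linear p.+1.
have br := lr_bracket_bilin (lr_tens_bilinear HT).
have br' := lr_bracket_bilin (lr_tens_bilinear HT').
have an w c : gA (lr_anchor w c) = lr_anchor (psi p w) (gA c).
  apply: (can_inj (iso_ringK phi)); rewrite iso_pow_inv_anchor.
  by rewrite !iso_ring_invK.
elim/lr_pow_ind: u => [u u' hu hu'|a u].
  rewrite [lr_bracket (u + u') v](linear_funD _ _ (bilinear_l v br')) !(linear_funD _ _ lin).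
  rewrite [RHS](linear_funD _ _ (bilinear_l _ br)).
  by congr (_ + _); [exact: hu | exact: hu'].
elim/lr_pow_ind: v => [v v' hv hv'|b v].
  rewrite [lr_bracket _ (v + v')](linear_funD _ _ (bilinear_r _ br')) !(linear_funD _ _ lin).
  rewrite [RHS](linear_funD _ _ (bilinear_r _ br)).
  by congr (_ + _); [exact: hv | exact: hv'].
rewrite !iso_pow_inv_pure [lr_bracket _ _](lr_tens_bracketE HT').
rewrite !(linear_funD _ _ lin) (linear_funN _ lin) !iso_pow_inv_pure.
by rewrite [RHS](lr_tens_bracketE HT) IH !iso_ring_inv_mul !an.
Qed.

Lemma iso_pow_inv_face p i u : psi p (face i u) = face i (psi p.+1 u).
Proof.
elim: p i u => [|p IH] i u.
  elim/lr_pow_ind: u => [u v hu hv|a X].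
    rewrite (linear_funD _ _ (face_linear HL' i)) !(linear_funD _ _ (@iso_pow_inv_linear _)).
    by rewrite hu hv -(linear_funD _ _ (face_linear HL i)).
  rewrite iso_pow_inv_pure !face_pure0 //; apply: (can_inj (iso_lieK phi)).
  by rewrite /= iso_lie_smul iso_ring_invK !iso_lie_invK.
elim/lr_pow_ind: u => [u v hu hv|a u].
  rewrite (linear_funD _ _ (face_linear HL' i)) !(linear_funD _ _ (@iso_pow_inv_linear _)).
  by rewrite hu hv -(linear_funD _ _ (face_linear HL i)).
case: i => [|i]; last by rewrite face_pureS // !iso_pow_inv_pure face_pureS // IH.
elim/lr_pow_ind: u => [u v hu hv|b u]; last first.
  by rewrite face_pure1 !iso_pow_inv_pure face_pure1 iso_ring_inv_mul.
rewrite (linear_funD _ _ (bilinear_r a (tpure_bilinear _ _))).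
rewrite (linear_funD _ _ (face_linear HL' 0)) !(linear_funD _ _ (@iso_pow_inv_linear _)).
by rewrite hu hv -(linear_funD _ _ (face_linear HL 0)).
Qed.

Let pull p (f : seq (lr_pow L p) -> A) (us : seq (lr_pow L' p)) : A' :=
  fA (f [seq psi p u | u <- us]).

Lemma pull_multilinear p (f : seq (lr_pow L p) -> A) :
  multilinear f -> multilinear (pull f).
Proof.
move=> h us vs k u v.
by rewrite /pull !map_cat /= (@iso_pow_inv_linear p) h linearP.
Qed.

(** [scalar_ext] evaluates at chosen representatives, which [psi] need not preserve. Multilinearity
    makes the value independent of them, so that pure tensors suffice. *)
Lemma pull_scalar_ext p (f : seq (lr_pow L p) -> A) us : multilinear f ->
  fA (scalar_ext f [seq psi p.+1 u | u <- us]) = scalar_ext (pull f) us.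
Proof.
elim: us f => [//|u us IH] f hf.
have lin := tlift_lin (scalar_ext_bilinear [seq psi p.+1 u | u <- us] hf).
have lin' := tlift_lin (scalar_ext_bilinear us (pull_multilinear hf)).
rewrite map_cons -[LHS]/(fA (tlift _ _)) -[RHS]/(tlift _ u).
elim/lr_pow_ind: u => [u v hu hv|a w].
  rewrite (linear_funD _ _ (@iso_pow_inv_linear p.+1)) (linear_funD _ _ lin).
  by rewrite (linear_funD _ _ lin') -hu -hv rmorphD.
rewrite iso_pow_inv_pure tlift_pure; last exact: scalar_ext_bilinear.
rewrite tlift_pure; last exact/scalar_ext_bilinear/pull_multilinear.
by rewrite rmorphM /= iso_ring_invK IH //; exact: multilinear_tail.
Qed.

Lemma omit_map (T T' : Type) (h : T -> T') i s : omit i (map h s) = map h (omit i s).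
Proof. by rewrite /omit map_cat map_take map_drop. Qed.

Lemma pull_d_vert p (f : seq (lr_pow L p) -> A) us :
  fA (d_vert f [seq psi p u | u <- us]) = d_vert (pull f) us.
Proof.
rewrite /d_vert rmorphM rmorph_sign size_map; congr (_ * _).
case: us => [|u us]; first by rewrite rmorph0.
rewrite map_cons -map_cons; move: {u us}(u :: us) => us.
have nthE (i : 'I_(size us)) : [seq psi p u | u <- us]`_i = psi p us`_i.
  exact: nth_map.
rewrite /chevalley_eilenberg rmorphD !rmorph_sum !size_map; congr (_ + _).
  by apply: eq_bigr => i _; rewrite rmorphM rmorph_sign /= nthE iso_pow_inv_anchor omit_map.
apply: eq_bigr => k _; rewrite rmorph_sum; apply: eq_bigr => j _.
rewrite rmorphM rmorph_sign !omit_map nthE.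
by rewrite (nth_map 0) ?(ltn_trans (ltn_ord j)) // -iso_pow_inv_bracket.
Qed.

Lemma pull_d_hor p (f : seq (lr_pow L p) -> A) us : multilinear f ->
  fA (d_hor f [seq psi p.+1 u | u <- us]) = d_hor (pull f) us.
Proof.
move=> hf; rewrite /d_hor rmorphD rmorph_sum; congr (_ + _); first exact: pull_scalar_ext.
apply: eq_bigr => i _; rewrite rmorphM rmorph_sign; congr (_ * fA (f _)).
by rewrite -!map_comp; apply: eq_map => u /=; rewrite iso_pow_inv_face.
Qed.

Lemma iso_cochain_d_tot (b : bicochain L) p us : (forall p, multilinear (b p)) ->
  iso_cochain phi (d_tot b) (p := p) us = d_tot (iso_cochain phi b) us.
Proof.
move=> hb; case: p us => [|p] us; first exact: pull_d_vert.
rewrite /iso_cochain [LHS]rmorphD rmorphM rmorph_sign.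
by congr (_ + _ * _); [exact: pull_d_hor | exact: pull_d_vert].
Qed.

Lemma iso_cochainP n (b : bicochain L) : cochain n b -> cochain n (iso_cochain phi b).
Proof.
move=> [h1 h2]; split=> [p|p us h]; last by rewrite /iso_cochain h2 ?rmorph0 // size_map.
have [m a] := h1 p; split; first exact: pull_multilinear.
by move=> us vs ws u; rewrite /iso_cochain !(map_cat, map_cons) a rmorph0.
Qed.

End Transport.

Section LowDegree.
Variables (K : fieldType) (A : comAlgType K) (L : lr_alg A).

Lemma d_vert2E (f : seq L -> A) u v : d_vert f [:: u; v] =
  lr_anchor u (f [:: v]) - lr_anchor v (f [:: u]) - f [:: lr_bracket u v].
Proof.
rewrite /d_vert /chevalley_eilenberg /= !big_ord_recl !big_ord0 /= /bump /=.
ring.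
Qed.

Lemma d_vert3E (f : seq L -> A) u v w : d_vert f [:: u; v; w] =
  - (lr_anchor u (f [:: v; w]) - lr_anchor v (f [:: u; w]) + lr_anchor w (f [:: u; v])
     - f [:: lr_bracket u v; w] + f [:: lr_bracket u w; v] - f [:: lr_bracket v w; u]).
Proof.
rewrite /d_vert /chevalley_eilenberg /= !big_ord_recl !big_ord0 /= /bump /=.
ring.
Qed.

Lemma d_hor0E (f : seq (lr_pow L 0) -> A) us :
  d_hor f us = scalar_ext f us - f [seq face 0 u | u <- us].
Proof. by rewrite /d_hor big_ord1 expr1 mulN1r. Qed.

Lemma d_hor1E (f : seq (lr_pow L 1) -> A) us : d_hor f us =
  scalar_ext f us - f [seq face 0 u | u <- us] + f [seq face 1 u | u <- us].
Proof.
by rewrite /d_hor !big_ord_recl big_ord0 expr1 mulN1r -signr_odd mul1r addr0 addrA.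
Qed.

End LowDegree.

(** * The inverse isomorphism and the transport of cosets *)

Section IsoSym.
Variables (K : fieldType) (A A' : comAlgType K) (L : lr_alg A) (L' : lr_alg A').
Variable phi : lr_iso L L'.

(** Serves to pull the data of S back to H^1(R), and to find preimages of cochains under
    transport. *)
Lemma iso_sym_exists : exists chi : lr_iso L' L,
  [/\ iso_ring chi =1 iso_ring_inv phi, iso_lie chi =1 iso_lie_inv phi,
      iso_ring_inv chi =1 iso_ring phi & iso_lie_inv chi =1 iso_lie phi].
Proof.
have gM : monoid_morphism (iso_ring_inv phi).
  by split=> [|a b]; [rewrite -(rmorph1 (iso_ring phi)) iso_ringK | exact: iso_ring_inv_mul].
pose gL := GRing.isLinear.Build K A' A *:%R _ (iso_ring_inv_linear phi).
pose gMM := GRing.isMonoidMorphism.Build A' A (iso_ring_inv phi) gM.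
pose g : {lrmorphism A' -> A} := HB.pack (iso_ring_inv phi) gL gMM.
pose uL := GRing.isLinear.Build K L' L *:%R _ (can2_linear (iso_lieK phi) (iso_lie_invK phi)).
pose u : {linear L' -> L} := HB.pack (iso_lie_inv phi) uL.
have uS a X : u (lr_smul a X) = lr_smul (g a) (u X).
  apply: (can_inj (iso_lieK phi)).
  by rewrite iso_lie_smul /= iso_ring_invK !iso_lie_invK.
have uB X Y : u (lr_bracket X Y) = lr_bracket (u X) (u Y).
  by apply: (can_inj (iso_lieK phi)); rewrite iso_lie_bracket /= !iso_lie_invK.
have uA X a : g (lr_anchor X a) = lr_anchor (u X) (g a).
  apply: (can_inj (iso_ringK phi)).
  by rewrite iso_lie_anchor /= !iso_ring_invK iso_lie_invK.
by exists (LRIso (iso_ring := g) (iso_ring_invK phi) (iso_ringK phi) (iso_lie := u)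
  (iso_lie_invK phi) (iso_lieK phi) uS uB uA).
Qed.

Lemma iso_pow_inv_sym (chi : lr_iso L' L) :
  iso_ring_inv chi =1 iso_ring phi -> iso_lie_inv chi =1 iso_lie phi ->
  forall p (u : lr_pow L' p), iso_pow_inv chi (iso_pow_inv phi u) = u.
Proof.
move=> hA hL; elim=> [|p IH] u; first by rewrite /= hL iso_lie_invK.
elim/lr_pow_ind: u => [u v hu hv|a u].
  rewrite (linear_funD _ _ (@iso_pow_inv_linear _ _ _ _ _ phi p.+1)).
  by rewrite (linear_funD _ _ (@iso_pow_inv_linear _ _ _ _ _ chi p.+1)) hu hv.
by rewrite !iso_pow_inv_pure IH hA iso_ring_invK.
Qed.

(** The image of c + d_tot d is c' + d_tot (phi d - b). Conversely c' + d_tot d is the image of c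
    plus the coboundary of b + d pulled back along the inverse isomorphism. *)
Lemma iso_coh_class n (c : bicochain L) (c' : bicochain L') (b : bicochain L') :
  lr_bilinear L -> lr_bilinear L' -> cochain n b ->
  (forall p us, c' p us = iso_cochain phi c us + d_tot b us) ->
  iso_coh phi (coh_class n c) = coh_class n c'.
Proof.
move=> HL HL' hb cE; apply/seteqP; split=> x.
  case=> y [d hd yE] <-; exists (fun p us => (-1) *: b p us + iso_cochain phi d us).
    exact: cochain_lin hb (iso_cochainP phi hd).
  move=> p us; rewrite d_tot_lin // cE -iso_cochain_d_tot //; last by move=> q; case: (hd.1 q).
  rewrite /iso_cochain yE rmorphD scaleN1r; zmod.
case=> d hd xE; have [chi [h1 h2 h3 h4]] := iso_sym_exists.
have chiK (e : bicochain L') p us : iso_cochain phi (iso_cochain chi e) (p := p) us = e p us.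
  rewrite /iso_cochain h1 iso_ring_invK -map_comp map_id_in // => u _.
  exact: iso_pow_inv_sym.
pose e : bicochain L' := fun p us => 1 *: b p us + d p us.
have he : cochain n e by exact: cochain_lin hb hd.
have hce := iso_cochainP chi he.
exists (fun p us => c p us + d_tot (iso_cochain chi e) us).
  by exists (iso_cochain chi e).
apply: functional_extensionality_dep => p; apply: funext => us.
have -> : iso_cochain phi (fun p us => c p us + d_tot (iso_cochain chi e) us) us
    = iso_cochain phi c us + iso_cochain phi (d_tot (iso_cochain chi e)) us.
  by rewrite /iso_cochain rmorphD.
rewrite iso_cochain_d_tot //; last by move=> q; case: (hce.1 q).
have -> : iso_cochain phi (iso_cochain chi e) = e.
  by apply: functional_extensionality_dep => q; apply: funext => vs; exact: chiK.
by rewrite d_tot_lin // scale1r addrA -cE xE.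
Qed.

End IsoSym.

(** * Vanishing of the differential outside its total degree *)

Section Degree.
Variables (K : fieldType) (A : comAlgType K) (L : lr_alg A).
Hypothesis HL : lr_bilinear L.

Lemma size_omit (T : Type) i (s : seq T) : (i < size s)%N -> size (omit i s) = (size s).-1.
Proof. by move=> h; rewrite /omit size_cat size_takel 1?ltnW // size_drop; lia. Qed.

Lemma d_vert_degree p m (f : seq (lr_pow L p) -> A) us :
  (forall ws, size ws != m -> f ws = 0) -> size us != m.+1 -> d_vert f us = 0.
Proof.
move=> h; rewrite /d_vert; case: us => [|u us]; first by rewrite mulr0.
move: {u us}(u :: us) => us hus.
have an := lr_anchor_bilin (lr_pow_bilinear p HL).
rewrite /chevalley_eilenberg !big1 ?addr0 ?mulr0 // => k _.
  apply: big1 => j _; rewrite h ?mulr0 //=.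
  have lj := ltn_ord j; have lk := ltn_ord k.
  have e := size_omit lk; rewrite size_omit ?e; last by lia.
  by apply: contra hus => /eqP <-; apply/eqP; lia.
rewrite h ?(linear_fun0 (bilinear_r _ an)) ?mulr0 // size_omit //.
by apply: contra hus => /eqP <-; rewrite prednK // (leq_ltn_trans _ (ltn_ord k)).
Qed.

Lemma d_hor_degree p m (f : seq (lr_pow L p) -> A) us :
  (forall ws, size ws != m -> f ws = 0) -> size us != m -> d_hor f us = 0.
Proof.
move=> h hus; rewrite /d_hor scalar_ext0 => [|ws e]; last by rewrite h ?e.
by rewrite big1 ?addr0 // => i _; rewrite h ?mulr0 // size_map.
Qed.

Lemma d_tot_degree n (b : bicochain L) p us : cochain n b ->
  (p + size us)%N != n.+1 -> d_tot b (p := p) us = 0.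
Proof.
move=> [_ h] hus.
have hv q (vs : seq (lr_pow L q)) : (q + size vs)%N != n.+1 -> d_vert (b q) vs = 0.
  move=> hvs; case: (leqP q n) => hq.
    by apply: (@d_vert_degree q (n - q)%N) => [ws|]; [move=> e; apply: h|]; lia.
  (* For q > n the component [b q] vanishes identically, and [size vs] is just a degree that does
     not fit. The case p > n below does the same with [(size us).+1]. *)
  rewrite (@d_vert_degree q (size vs)) => // [ws|]; last by lia.
  by move=> _; apply: h; lia.
case: p us hus => [|p] us hus /=; first exact: (hv 0%N).
rewrite (hv p.+1) // mulr0 addr0.
case: (leqP p n) => hp.
  by apply: (@d_hor_degree p (n - p)%N) => [ws|]; [move=> e; apply: h|]; lia.
by apply: (@d_hor_degree p (size us).+1) => [ws|]; [move=> e; apply: h|]; lia.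
Qed.

End Degree.

(** * Morita invariance of the canonical class *)

(** A derivation of R kills the scalars [k%:A], so the Leibniz rule over R contains K-linearity. *)
Lemma leibnizK (K : fieldType) (S R : algType K) (P : bimod S R)
    (D : der S) (D' : der R) (theta : P -> P) k y :
  leibniz D D' theta -> theta (k%:A *: y) = k%:A *: theta y.
Proof.
move=> [_ h _]; have D1 : D' 1 = 0.
  by apply: (addrI (D' 1)); rewrite addr0 -[in RHS](mulr1 1) derM mulr1 mul1r.
by rewrite h derZ D1 scaler0 scale0r add0r.
Qed.

Lemma leibniz_sub (K : fieldType) (S R : algType K) (P : bimod S R)
    (D E : der S) (D' E' : der R) (theta eta : P -> P) :
  leibniz D D' theta -> leibniz E E' eta ->
  leibniz (D - E) (D' - E') (fun y => theta y - eta y).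
Proof.
move=> h h'; have := leibniz_lin (-1) h' h; rewrite !scaleN1r ![- _ + _]addrC.
have <- : (fun y => -1 *: eta y + theta y) = (fun y => theta y - eta y).
  by apply: funext => y; rewrite !scaleN1r addrC.
by [].
Qed.

Lemma leibniz_central (K : fieldType) (S R : algType K) (P : bimod S R) (sigma : P -> P) :
  morita_bimod P -> leibniz 0 0 sigma ->
  exists b : center R, forall y, sigma y = val b *: y.
Proof.
move=> HP [h1 h2 h3]; have [//||r rE] := lact_full HP (f := sigma).
  by move=> y s; rewrite h3 -[(0 : der S) s]/(0 : S) ract0r addr0.
have rc : r \in center_pred (S := R).
  apply/center_predP => t; apply: (lact_inj HP) => y.
  by rewrite -!scalerA -!rE h2 -[(0 : der R) t]/(0 : R) scale0r add0r.
by exists (Center rc).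
Qed.

Section CanonicalClassTransport.
Variables (K : fieldType) (S R : algType K) (P : bimod S R).
Hypothesis HP : morita_bimod P.
Variables (phi : lr_iso (HH1_lr S) (HH1_lr R)) (chi : lr_iso (HH1_lr R) (HH1_lr S)).
Hypothesis phiA : forall a (y : P), val (iso_ring phi a) *: y = ract y (val a).
Hypothesis chiA : iso_ring chi =1 iso_ring_inv phi.
Hypothesis chiL : iso_lie chi =1 iso_lie_inv phi.
Variables (secS : sections S) (secR : sections R).
Local Notation A := (center R).
Local Notation L := (HH1_lr R).
Local Notation pS := (fun X : L => der_lift secS (iso_lie chi X)).
Local Notation pR := (der_lift secR).
Variable nabla : L -> P -> P.
Hypothesis nabla_leibniz : forall X, leibniz (pS X) (pR X) (nabla X).
Hypothesis nabla_lin : forall k X Y y,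
  nabla (k *: X + Y) y = k%:A *: nabla X y + nabla Y y.

Let smul_bilin := lr_smul_bilin (HH1_lr_bilinear R).
Let br_bilin := lr_bracket_bilin (HH1_lr_bilinear R).
Let an_bilin := lr_anchor_bilin (HH1_lr_bilinear R).

Lemma curvature_center X Y : exists b : A, forall y,
  nabla X (nabla Y y) - nabla Y (nabla X y) - nabla (lr_bracket X Y) y
  - (sec_t secR X Y *: y - ract y (sec_t secS (iso_lie chi X) (iso_lie chi Y)))
  = val b *: y.
Proof.
have h := leibniz_sub (leibniz_sub (leibniz_bracket (nabla_leibniz X) (nabla_leibniz Y))
   (nabla_leibniz (lr_bracket X Y)))
  (leibniz_ad P (sec_t secR X Y) (sec_t secS (iso_lie chi X) (iso_lie chi Y))).
apply: (leibniz_central HP); move: h.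
by rewrite iso_lie_bracket !ad_liftK ?subrr //; exact: inner_curvature.
Qed.

Lemma defect_center (a : A) X : exists b : A, forall y,
  val a *: nabla X y - nabla (lr_smul a X) y
  - (sec_s0 secR a X *: y - ract y (sec_s0 secS (iso_ring chi a) (iso_lie chi X)))
  = val b *: y.
Proof.
have hc : leibniz (der_smul (iso_ring chi a) (pS X)) (der_smul a (pR X))
    (fun y => val a *: nabla X y).
  have [h1 h2 h3] := nabla_leibniz X; split.
  - by move=> y z; rewrite h1 scalerDr.
  - by move=> r y; rewrite h2 scalerDr !scalerA (centerP a r).
  - move=> y s; rewrite h3 scalerDr /= ractM chiA -phiA iso_ring_invK.
    by rewrite !ractZl.
have h := leibniz_sub (leibniz_sub hc (nabla_leibniz (lr_smul a X)))
  (leibniz_ad P (sec_s0 secR a X) (sec_s0 secS (iso_ring chi a) (iso_lie chi X))).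
apply: (leibniz_central HP); move: h.
by rewrite iso_lie_smul !ad_liftK ?subrr //; exact: inner_smul_defect.
Qed.

Let beta X Y : A := sval (cid (curvature_center X Y)).
Let gamma a X : A := sval (cid (defect_center a X)).

Let betaK X Y y : val (beta X Y) *: y =
  nabla X (nabla Y y) - nabla Y (nabla X y) - nabla (lr_bracket X Y) y
  - (sec_t secR X Y *: y - ract y (sec_t secS (iso_lie chi X) (iso_lie chi Y))).
Proof. by rewrite /beta; case: cid. Qed.
Let gammaK a X y : val (gamma a X) *: y =
  val a *: nabla X y - nabla (lr_smul a X) y
  - (sec_s0 secR a X *: y - ract y (sec_s0 secS (iso_ring chi a) (iso_lie chi X))).
Proof. by rewrite /gamma; case: cid. Qed.

Let nabla_add X Y y : nabla (X + Y) y = nabla X y + nabla Y y.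
Proof. by rewrite -[X]scale1r nabla_lin !scale1r. Qed.
Let nablaZ k X y : nabla (k *: X) y = k%:A *: nabla X y.
Proof.
have n0 : nabla 0 y = 0 by apply: (addrI (nabla 0 y)); rewrite -nabla_add !addr0.
by rewrite -[k *: X]addr0 nabla_lin n0 addr0.
Qed.
Let nablaD X y z : nabla X (y + z) = nabla X y + nabla X z.
Proof. by case: (nabla_leibniz X). Qed.
Let nablaK X k y : nabla X (k%:A *: y) = k%:A *: nabla X y.
Proof. exact: leibnizK (nabla_leibniz X). Qed.

Let center_eq (b c : A) : (forall y : P, val b *: y = val c *: y) -> b = c.
Proof. by move=> h; apply/val_inj/(lact_inj HP). Qed.
Let valZ k (b c : A) (y : P) :
  val (k *: b + c) *: y = k%:A *: (val b *: y) + val c *: y.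
Proof.
by rewrite scalerA mulr_algl -scalerDl.
Qed.

(** Although [beta] is chosen value by value, each value is determined by its action on P, where the
    defining expression is bilinear. The same holds for [gamma]. *)
Lemma beta_bilinear : bilinear_map beta.
Proof.
have tR := sec_t_bilinear secR; have tS := sec_t_bilinear secS.
have e (k : K) (r r' : R) (y : P) : (k *: r + r') *: y = k%:A *: (r *: y) + r' *: y.
  by rewrite scalerDl scalerA mulr_algl.
have e' (k : K) (s s' : S) (y : P) :
    ract y (k *: s + s') = k%:A *: ract y s + ract y s'.
  by rewrite ractDr ractZr.
split=> [k X X' Y|k X Y Y']; apply: center_eq => y; rewrite valZ !betaK;
  rewrite (linearP (iso_lie chi)).
  rewrite (bilinear_l _ br_bilin) (bilinear_l _ tR) (bilinear_l _ tS) e e'.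
  by rewrite !nabla_lin nablaD nablaK !(scalerDr, scalerN); zmod.
rewrite (bilinear_r _ br_bilin) (bilinear_r _ tR) (bilinear_r _ tS) e e'.
by rewrite !nabla_lin nablaD nablaK !(scalerDr, scalerN); zmod.
Qed.

Lemma beta_alternating X : beta X X = 0.
Proof.
apply: center_eq => y; rewrite betaK !sec_txx HH1_bracketxx -[0](scale0r (0 : L)).
by rewrite nablaZ !scale0r ract0r !subrr.
Qed.

Lemma gamma_bilinear : bilinear_map gamma.
Proof.
have sR := sec_s0_bilinear secR; have sS := sec_s0_bilinear secS.
have e (k : K) (r r' : R) (y : P) : (k *: r + r') *: y = k%:A *: (r *: y) + r' *: y.
  by rewrite scalerDl scalerA mulr_algl.
have e' (k : K) (s s' : S) (y : P) :
    ract y (k *: s + s') = k%:A *: ract y s + ract y s'.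
  by rewrite ractDr ractZr.
split=> [k a a' X|k a X X']; apply: center_eq => y; rewrite valZ !gammaK.
  rewrite valZ (linearP (iso_ring chi)) (bilinear_l _ smul_bilin) (bilinear_l _ sR).
  rewrite (bilinear_l _ sS) e e'.
  by rewrite !nabla_lin !(scalerDr, scalerN); zmod.
rewrite (linearP (iso_lie chi)) (bilinear_r _ smul_bilin) (bilinear_r _ sR).
rewrite (bilinear_r _ sS) e e'.
rewrite !nabla_lin !(scalerDr, scalerN) [val a *: (_ *: _)]scalerA.
by rewrite (_ : val a * k%:A = k%:A * val a) -?scalerA ?mulr_algr ?mulr_algl //; zmod.
Qed.

Let Gamma : lr_pow L 1 -> A := tlift gamma.
Let Gamma_linear : linear Gamma. Proof. exact: tlift_lin gamma_bilinear. Qed.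
Let GammaE a X : Gamma (tpure a X) = gamma a X.
Proof. exact: tlift_pure gamma_bilinear. Qed.

(** On three arguments [d_vert] is minus the Chevalley-Eilenberg differential, so - beta yields the
    right side of [canon_f_compare]. On two arguments there is no such sign, but the factor (-1)^p
    at p = 1 takes its place for - Gamma. *)
Definition comparison_cochain : bicochain L := fun p =>
  match p return seq (lr_pow L p) -> A with
  | 0 => fun us => if us is [:: X; Y] then - beta X Y else 0
  | 1 => fun us => if us is [:: u] then - Gamma u else 0
  | _ => fun=> 0
  end.

Lemma comparison_cochainP : cochain 2 comparison_cochain.
Proof.
split=> [[|[|p]]|[|[|p]] us] //=; first split.
- move=> [|x [|x' us]] vs k u v /=.
  + case: vs => [|y [|? ?]]; rewrite ?scaler0 ?addr0 //.
    by rewrite (bilinear_l y beta_bilinear) opprD scalerN.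
  + case: vs => [|? ?]; rewrite ?scaler0 ?addr0 //.
    by rewrite (bilinear_r x beta_bilinear) opprD scalerN.
  + by case: us => [|? ?]; rewrite scaler0 addr0.
- move=> [|x us] vs ws u /=.
    case: vs => [|? [|? ?]] //=; case: ws => [|? ?] //.
    by rewrite beta_alternating oppr0.
  by case: us => [|? [|? ?]] //=; case: vs.
- split=> [[|x us] vs k u v|[|x us] vs ws u] /=.
  + case: vs => [|? ?]; rewrite ?scaler0 ?addr0 //.
    by rewrite Gamma_linear opprD scalerN.
  + by case: us => [|? ?]; rewrite scaler0 addr0.
  + by case: vs.
  + by case: us.
- by split=> [us vs k u v|us vs ws u]; rewrite ?scaler0 ?addr0.
- by case: us => [|? [|? [|? ?]]].
- by case: us => [|? [|? ?]].
Qed.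

(** Reduces an equation in A to one between operators on P, the form of the comparison lemmas. *)
Let ring_inner (c : A) (d : center S) (e : A) :
  (forall y : P, val c *: y - ract y (val d) = val e *: y) -> c = iso_ring phi d + e.
Proof.
move=> h; apply: center_eq => y; have := h y; rewrite -phiA => he.
by rewrite [RHS]scalerDl -he addrC subrK.
Qed.

Let act_center (a : A) (y : P) : val a *: y = ract y (val (iso_ring chi a)).
Proof. by rewrite chiA -phiA iso_ring_invK. Qed.

Let betaE X Y y :
  sec_t secR X Y *: y - ract y (sec_t secS (iso_lie chi X) (iso_lie chi Y)) =
  nabla X (nabla Y y) - nabla Y (nabla X y) - nabla (lr_bracket X Y) y
  - val (beta X Y) *: y.
Proof. by rewrite betaK; zmod. Qed.
Let gammaE (a : A) X y :
  sec_s0 secR a X *: y - ract y (sec_s0 secS (iso_ring chi a) (iso_lie chi X)) =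
  val a *: nabla X y - nabla (lr_smul a X) y - val (gamma a X) *: y.
Proof. by rewrite gammaK; zmod. Qed.

Local Notation psi p := (@iso_pow_inv K (center S) A (HH1_lr S) L phi p).
Local Notation b := comparison_cochain.

Let b_multilinear (p : nat) : multilinear (b (p := p)).
Proof. by case: (comparison_cochainP.1 p). Qed.

Lemma canon_f_coboundary X Y Z : canon_cocycle secR [:: X; Y; Z : lr_pow L 0] =
  iso_cochain phi (canon_cocycle secS) [:: X; Y; Z : lr_pow L 0]
  + d_tot b [:: X; Y; Z : lr_pow L 0].
Proof.
have an (W : L) c : lr_anchor W (- c) = - lr_anchor W c.
  exact: linear_funN (bilinear_r W an_bilin).
set e := d_tot b _.
have eE : e = lr_anchor X (beta Y Z) - lr_anchor Y (beta X Z) + lr_anchor Z (beta X Y)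
  - beta (lr_bracket X Y) Z + beta (lr_bracket X Z) Y - beta (lr_bracket Y Z) X.
  rewrite /e [LHS](@d_vert3E _ _ L).
  rewrite -[LHS]/(- (lr_anchor X (- beta Y Z) - lr_anchor Y (- beta X Z)
    + lr_anchor Z (- beta X Y) - - beta (lr_bracket X Y) Z
    + - beta (lr_bracket X Z) Y - - beta (lr_bracket Y Z) X)).
  by rewrite !an; ring.
apply: ring_inner => y; rewrite !canon_cocycleE eE /canon_val /= -!chiL.
exact: (canon_f_compare nabla_leibniz nabla_add betaE).
Qed.

Lemma canon_g_coboundary (u v : lr_pow L 1) : canon_cocycle secR [:: u; v] =
  iso_cochain phi (canon_cocycle secS) [:: u; v] + d_tot b [:: u; v].
Proof.
have HT := lr_tens_bilinear (HH1_lr_bilinear R).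
have an_lin := lr_anchor_bilin HT; have br_lin := lr_bracket_bilin HT.
have an (w : lr_tens L) c : lr_anchor w (- c) = - lr_anchor w c.
  exact: linear_funN (bilinear_r w an_lin).
(* The coboundary in a form whose bilinearity can be read off term by term, which allows both
   arguments to be taken pure. *)
pose e (u v : lr_pow L 1) : A :=
  scalar_ext (b (p := 0)) [:: u; v] + beta (face 0 u) (face 0 v)
  + (lr_anchor u (Gamma v) - lr_anchor v (Gamma u) - Gamma (lr_bracket u v)).
have -> : d_tot b [:: u; v] = e u v.
  rewrite -[LHS]/(d_hor (b (p := 0)) [:: u; v] + (-1) ^+ 1 * d_vert (b (p := 1)) [:: u; v]).
  rewrite d_hor0E (@d_vert2E _ _ (lr_tens L)) expr1 mulN1r /e.
  rewrite -[b [seq _ | _ <- _]]/(- beta (face 0 u) (face 0 v)).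
  rewrite -[b [:: u]]/(- Gamma u) -[b [:: v]]/(- Gamma v).
  rewrite -[b [:: lr_bracket _ _]]/(- Gamma (lr_bracket u v)).
  by rewrite !an; ring.
apply: ring_inner => y; rewrite !canon_cocycleE.
rewrite -[LHS]/(canon_g secR u v *: y - ract y (canon_g secS (psi 1 u) (psi 1 v))).
have gR := canon_g_bilinear secR; have gS := canon_g_bilinear secS.
have psi_lin : linear (psi 1) by exact: iso_pow_inv_linear.
have f_lin : linear (@face K A L 0 0) by apply: face_linear; exact: HH1_lr_bilinear.
have e_bilin : bilinear_map e.
  apply: bilinear_add; first apply: bilinear_add.
  - apply: bilinearI => [w|w].
      have h := tlift_lin (scalar_ext_bilinear [:: w] (@b_multilinear 0)); exact: h.
    apply: tlift_param => a X.
    apply: linear_comp (bilinear_r a (bilinear_mul A)) _.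
    exact: tlift_lin (scalar_ext_bilinear [::] (multilinear_tail X (@b_multilinear 0))).
  - exact: (bilinear_pre beta_bilinear f_lin f_lin).
  - apply: bilinear_add; last exact: bilinear_opp (bilinear_post br_lin Gamma_linear).
    apply: bilinear_add.
      exact: bilinear_pre an_lin (@linear_id _ _) Gamma_linear.
    apply/bilinear_opp/bilinear_swap.
    exact: bilinear_pre an_lin (@linear_id _ _) Gamma_linear.
have eD (c d : A) : val (c + d) *: y = val c *: y + val d *: y by exact: scalerDl.
elim/lr_pow_ind: u => [u u' hu hu'|a X].
  rewrite (linear_funD _ _ psi_lin) (linear_funD _ _ (bilinear_l _ gR)).
  rewrite (linear_funD _ _ (bilinear_l _ gS)) (linear_funD _ _ (bilinear_l _ e_bilin)).
  by rewrite eD -hu -hu' scalerDl ractDr; zmod.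
elim/lr_pow_ind: v => [v v' hv hv'|b Y].
  rewrite (linear_funD _ _ psi_lin) (linear_funD _ _ (bilinear_r _ gR)).
  rewrite (linear_funD _ _ (bilinear_r _ gS)) (linear_funD _ _ (bilinear_r _ e_bilin)).
  by rewrite eD -hv -hv' scalerDl ractDr; zmod.
rewrite !iso_pow_inv_pure -!chiA -![iso_pow_inv _ _]chiL.
rewrite (canon_g_compare act_center nabla_leibniz nabla_add betaE gammaE).
apply: (congr1 (fun c : A => val c *: y)).
rewrite /e !face_pure0; try exact: HH1_lr_bilinear.
rewrite !(lr_tens_anchorE (HH1_lr_bilinear R)) (lr_tens_bracketE (HH1_lr_bilinear R)).
rewrite !(linear_funD _ _ Gamma_linear) (linear_funN _ Gamma_linear) !GammaE.
rewrite !HH1_anchor_smul /=.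
rewrite (tlift_pure _ _ (scalar_ext_bilinear [:: tpure b Y] (@b_multilinear 0))) /=.
rewrite (tlift_pure _ _ (scalar_ext_bilinear [::] (multilinear_tail X (@b_multilinear 0)))) /=.
by congr (_ + _ + _); rewrite !mulrN mulrA.
Qed.

Lemma canon_h_coboundary (u : lr_pow L 2) : canon_cocycle secR [:: u] =
  iso_cochain phi (canon_cocycle secS) [:: u] + d_tot b [:: u].
Proof.
pose e (u : lr_pow L 2) : A :=
  scalar_ext (b (p := 1)) [:: u] + Gamma (face 0 u) - Gamma (face 1 u).
have -> : d_tot b [:: u] = e u.
  rewrite -[LHS]/(d_hor (b (p := 1)) [:: u] + (-1) ^+ 2 * d_vert (b (p := 2)) [:: u]).
  rewrite d_hor1E (@d_vert_degree _ _ _ (HH1_lr_bilinear R) 2 1) // mulr0 addr0 /e.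
  by rewrite -[b [seq face 0 u | u <- [:: u]]]/(- Gamma _) opprK.
apply: ring_inner => y; rewrite !canon_cocycleE.
rewrite -[LHS]/(canon_h secR u *: y - ract y (canon_h secS (psi 2 u))).
have hR := canon_h_linear secR; have hS := canon_h_linear secS.
have psi_lin p : linear (psi p) by exact: iso_pow_inv_linear.
have f_lin i : linear (@face K A L 1 i) by apply: face_linear; exact: HH1_lr_bilinear.
have e_lin : linear e.
  apply: linear_add; first apply: linear_add.
  - exact: tlift_lin (scalar_ext_bilinear [::] (@b_multilinear 1)).
  - exact: linear_comp Gamma_linear (f_lin _).
  - apply: linear_opp; exact: linear_comp Gamma_linear (f_lin _).
have eD (c d : A) : val (c + d) *: y = val c *: y + val d *: y by exact: scalerDl.
elim/lr_pow_ind: u => [u u' hu hu'|a u].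
  rewrite (linear_funD _ _ (psi_lin 2)) (linear_funD _ _ hR) (linear_funD _ _ hS).
  by rewrite (linear_funD _ _ e_lin) eD -hu -hu' scalerDl ractDr; zmod.
elim/lr_pow_ind: u => [u u' hu hu'|b X].
  rewrite (linear_funD _ _ (bilinear_r a (tpure_bilinear _ _))).
  rewrite (linear_funD _ _ (psi_lin 2)) (linear_funD _ _ hR) (linear_funD _ _ hS).
  by rewrite (linear_funD _ _ e_lin) eD -hu -hu' scalerDl ractDr; zmod.
rewrite !iso_pow_inv_pure -!chiA -![iso_pow_inv _ _]chiL.
rewrite (canon_h_compare act_center gammaE).
apply: (congr1 (fun c : A => val c *: y)).
rewrite /e face_pure1 face_pureS ?face_pure0; try exact: HH1_lr_bilinear.
rewrite !GammaE /=.
rewrite (tlift_pure _ _ (scalar_ext_bilinear [::] (@b_multilinear 1))) /= GammaE; ring.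
Qed.

Lemma canonical_class_transport :
  iso_coh phi (canonical_class secS) = canonical_class secR.
Proof.
apply: iso_coh_class comparison_cochainP _; try exact: HH1_lr_bilinear.
move=> p us; case: (eqVneq (p + size us)%N 3%N) => [|h]; last first.
  rewrite (d_tot_degree (HH1_lr_bilinear R) comparison_cochainP) // addr0.
  have z (T : algType K) (sec : sections T) (vs : seq (lr_pow (HH1_lr T) p)) :
      size vs = size us -> canon_cocycle sec vs = 0.
    move=> sz; rewrite -sz in h; apply/val_inj; rewrite canon_cocycleE.
    by case: p vs h {us sz} => [|[|[|p]]] [|x [|y [|t [|? ?]]]].
  by rewrite /iso_cochain !z ?size_map // rmorph0.
case: p us => [|[|[|[|p]]]] us //.
- by case: us => [|X [|Y [|Z [|? ?]]]] // _; exact: canon_f_coboundary.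
- by case: us => [|u [|v [|? ?]]] // _; exact: canon_g_coboundary.
- by case: us => [|u [|? ?]] // _; exact: canon_h_coboundary.
(* Bidegree (3, 0): both cocycles vanish there, and so does the coboundary, as the comparison
   cochain is 0 from p = 2 on. *)
- case: us => // _.
  have z (T : algType K) (sec : sections T) :
      canon_cocycle sec ([::] : seq (lr_pow (HH1_lr T) 3)) = 0.
    by apply/val_inj; rewrite canon_cocycleE.
  rewrite /iso_cochain !z rmorph0 add0r /= /d_hor /d_vert /= big1 ?mulr0 ?addr0 // => i _.
  by rewrite mulr0.
Qed.

End CanonicalClassTransport.

Theorem lemma5p1 (K : fieldType) (S R : algType K) (E : morita_equiv S R) :
  exists phi : lr_iso (HH1_lr S) (HH1_lr R),
    canonical_iso E phi /\
    forall (secS : sections S) (secR : sections R),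
      iso_coh phi (canonical_class secS) = canonical_class secR.
Proof.
have HP := mor_bimodule_morita E; have [phi [phiA phiL]] := canonical_iso_exists HP.
exists phi; split=> [|secS secR]; first by split.
have [chi [chiA chiL _ _]] := iso_sym_exists phi.
have [|||nabla [nabla_leibniz nabla_lin]] := @leibniz_lift K S R (mor_bimodule E) (HH1 R)
  (fun X => der_lift secS (iso_lie chi X)) (der_lift secR) secR HP.
- by move=> k X Y; rewrite !linearP.
- exact: linearP.
(* The two lifts of X have classes phi^-1(X) and X, so they correspond by the characterization of
   phi on H^1. *)
- by move=> X; apply/phiL; rewrite !der_liftK chiL iso_lie_invK.
apply: (canonical_class_transport HP (chi := chi) _ _ _ nabla_leibniz) => //.
by move=> a; apply/phiA.
Qed.
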